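(* Any upper bound for the admissible vertex count $\sigma$ must grow at a rate of at least $\Omega(17^{n/4}) \simeq \Omega(2.03^n)$. That is, if $f$ is a real-valued function on the positive integers such that $\sigma(\mathcal{T}) \leq f(n)$ for every $n$ and every closed 3-manifold triangulation $\mathcal{T}$ of size $n$, then $f(n) \in \Omega(17^{n/4})$, i.e. there are constants $c>0$ and $n_0$ such that $f(n) \geq c\cdot 17^{n/4}$ for all $n \geq n_0$.
   Context: A closed 3-manifold triangulation of size $n$ is a collection of $n$ tetrahedra whose $4n$ triangular faces are affinely identified in $2n$ pairs so that the resulting topological space is a closed 3-manifold. (Faces of the same tetrahedron may be identified, and several vertices or edges of the same tetrahedron may become identified as a consequence of the face gluings.) In each tetrahedron there are four types of normal triangle (one for each vertex $v$, separating $v$ from the other three vertices) and three types of normal quadrilateral (one for each way of splitting the four vertices into two pairs, separating the two pairs). Use coordinates in $\mathbb{R}^{7n}$ indexed by these $7n$ types. The matching equations are the following homogeneous linear equations: for each pair of identified faces $F \leftrightarrow F'$ and each vertex $v$ of $F$, corresponding to the vertex $v'$ of $F'$, let $\Delta,\Delta'$ be the tetrahedra containing $F,F'$ on the two sides of the gluing. Then $t+q = t'+q'$, where $t$ is the coordinate of the triangle type at $v$ in $\Delta$, $q$ is the coordinate of the quadrilateral type in $\Delta$ that pairs $v$ with the vertex of $\Delta$ opposite $F$, and $t',q'$ are defined likewise from $v',F',\Delta'$. The quadrilateral constraints require that, for each tetrahedron, at most one of its three quadrilateral coordinates is non-zero. The projective solution space is the polytope in $\mathbb{R}^{7n}$ obtained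 as the cross-section $\sum_i x_i = 1$ of the cone of non-negative vectors satisfying the matching equations. The admissible vertex count $\sigma(\mathcal{T})$ is the number of vertices of this polytope that satisfy the quadrilateral constraints. (These are in bijection with the vertex normal surfaces of $\mathcal{T}$.) *)

(* Defs.v *)
From HB Require Import structures.
From mathcomp Require Import all_boot all_order all_fingroup all_algebra.
From mathcomp Require Import generic_quotient finmap.
From mathcomp Require Import all_classical all_reals all_analysis.
From Stdlib Require Import Relation_Operators.
Import Order.TTheory GRing.Theory Num.Theory.
Import numFieldNormedType.Exports.

Set Implicit Arguments.
Unset Strict Implicit.
Unset Printing Implicit Defensive.

Local Open Scope classical_set_scope.
Local Open Scope ring_scope.
Local Open Scope quotient_scope.

(* The vertices of every tetrahedron are labelled by 'I_4, and (i, F) denotes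
   the face of tetrahedron i opposite its vertex F.  If glue i F = (j, p), this
   face is glued to the face (j, p F) by the affine map which sends the vertex
   v != F of tetrahedron i to the vertex p v of tetrahedron j.  A bijection
   between the vertices of the two faces has a unique extension to a
   permutation p of 'I_4 matching the opposite vertices, so that p carries no
   more information than the face identification.  The two laws say that the
   4n faces are identified in pairs. *)
Record gluing (n : nat) := Gluing {
  glue : 'I_n -> 'I_4 -> 'I_n * 'S_4 ;
  glue_sym : forall i F j p,
    glue i F = (j, p) -> glue j (p F) = (i, p^-1%g) ;
  glue_neq : forall i F j p, glue i F = (j, p) -> (j, p F) <> (i, F) }.

Section Realization.
Variables (R : realType) (n : nat) (T : gluing n).

(* the standard 3-simplex, in barycentric coordinates *)
Definition simplex3 : set 'rV[R]_4 :=
  [set x | (forall v, 0 <= x ord0 v) /\ \sum_v x ord0 v = 1].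

Definition tetrahedra : topologicalType := {i : 'I_n & set_type simplex3}.

Definition tet_index (a : tetrahedra) : 'I_n := projT1 a.
Definition bary (a : tetrahedra) (v : 'I_4) : R := set_val (projT2 a) ord0 v.

(* a lies on a face F of its tetrahedron, and b is the image of a under the
   affine map gluing that face *)
Definition glued (a b : tetrahedra) : Prop :=
  exists F p, [/\ glue T (tet_index a) F = (tet_index b, p),
                  bary a F = 0 &
                  forall v, bary b (p v) = bary a v].

Definition same_point : rel tetrahedra :=
  fun a b => `[< clos_refl_sym_trans tetrahedra glued a b >].

Lemma same_point_is_equiv : equiv_class_of same_point.
Proof.
split=> [a|a b|b a c].
- exact/asboolP/rst_refl.
- by apply/asboolP/asboolP; exact: rst_sym.
- by move=> /asboolP ab /asboolP bc; apply/asboolP; exact: rst_trans ab bc.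
Qed.

Canonical same_point_equiv := EquivRelPack same_point_is_equiv.

Definition realization : topologicalType :=
  quotient_topology {eq_quot same_point_equiv}.

End Realization.

Section Manifold.
Variable R : realType.

Definition homeomorphic_sets (X Y : topologicalType) (U : set X) (V : set Y) :=
  exists (f : set_type U -> set_type V) (g : set_type V -> set_type U),
    [/\ continuous f, continuous g, cancel f g & cancel g f].

Definition locally_euclidean (d : nat) (X : topologicalType) :=
  forall x : X, exists (U : set X) (V : set 'rV[R]_d),
    [/\ open U, U x, open V & homeomorphic_sets U V].

(* Having charts onto open subsets of R^d at all points, such a manifold has no
   boundary.  Connectedness is not part of the definition. *)
Definition closed_manifold (d : nat) (X : topologicalType) :=
  [/\ hausdorff_space X, @second_countable X, locally_euclidean d X &
      compact [set: X]].

Definition closed_3manifold_triangulation (n : nat) (T : gluing n) :=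
  closed_manifold 3 (realization R T).

End Manifold.

(* A normal quadrilateral type is a splitting of the four vertices into two
   pairs. *)
Definition is_splitting (Q : {set {set 'I_4}}) : bool :=
  finset.partition Q [set: 'I_4] && [forall B in Q, #|B| == 2%N].
Definition quad_type : finType := {Q : {set {set 'I_4}} | is_splitting Q}.

Definition pairs_up (Q : quad_type) (v w : 'I_4) : bool :=
  ([set v; w])%SET \in val Q.

Lemma is_splittingP (Q : {set {set 'I_4}}) (v w : 'I_4) : v != w ->
  is_splitting Q && ([set v; w]%SET \in Q) =
  (Q == [set [set v; w]; ~: [set v; w]])%SET.
Proof.
move=> vw; set B := [set v; w]%SET.
have cB : #|B| = 2%N by rewrite cards2 vw.
have cBC : #|finset.setC B| = 2%N by rewrite cardsCs finset.setCK card_ord cB.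
have BCneq : B != finset.setC B.
  by apply/eqP => e; have := finset.in_setC v B; rewrite -e !inE eqxx.
have B0 : B != finset.set0 by rewrite -card_gt0 cB.
have BC0 : finset.setC B != finset.set0 by rewrite -card_gt0 cBC.
apply/idP/eqP => [/andP[/andP[]]|->].
  move=> /and3P[/eqP covQ /finset.trivIsetP triv Q0] /forallP card2 BQ.
  have blk C : C \in Q -> C != B -> C = finset.setC B.
    move=> CQ CB; apply/eqP; rewrite eqEcard cBC.
    have /implyP/(_ CQ)/eqP -> := card2 C.
    by rewrite leqnn andbT -finset.disjoints_subset triv.
  apply/finset.setP => C; rewrite !inE; apply/idP/orP => [CQ|[/eqP->//|/eqP->]].
    by case: (eqVneq C B) => [|/(blk _ CQ) ->]; [left|right].
  have /set0Pn[u uBC] := BC0.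
  have : u \in finset.cover Q by rewrite covQ inE.
  case/finset.bigcupP => D DQ uD; rewrite -(blk _ DQ) //.
  by apply: contraTneq uD => ->; rewrite -finset.in_setC.
rewrite !inE eqxx andbT; apply/andP; split.
  apply/and3P; split.
  - by rewrite /finset.cover big_setU1 ?inE //= big_set1 finset.setUCr.
  - apply/finset.trivIsetP => C D; rewrite !inE.
    case/orP=> /eqP-> /orP[] /eqP->; rewrite ?eqxx // => _.
      by rewrite finset.disjoints_subset finset.setCK.
    by rewrite finset.disjoints_subset.
  - by rewrite !inE negb_or !(eq_sym finset.set0) B0 BC0.
by apply/forallP => C; rewrite !inE; apply/implyP => /orP[]/eqP->; apply/eqP.
Qed.

Lemma pairs_up_unique (v w : 'I_4) : v != w -> exists! Q, pairs_up Q v w.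
Proof.
move=> vw; pose Q0 := ([set [set v; w]; ~: [set v; w]])%SET.
have /andP[sQ0 mQ0] : is_splitting Q0 && ([set v; w]%SET \in Q0).
  by rewrite is_splittingP.
exists (exist _ Q0 sQ0); split=> // Q pQ; apply/val_inj/esym/eqP => /=.
by rewrite -is_splittingP // (valP Q).
Qed.

Section NormalCoordinates.
Variables (R : realType) (n : nat) (T : gluing n).

(* inl v is the triangle type separating v from the other vertices *)
Definition normal_type : finType := ('I_n * ('I_4 + quad_type))%type.

Definition normal_vector := {ffun normal_type -> R^o}.

Definition tri_coord (x : normal_vector) (i : 'I_n) (v : 'I_4) : R :=
  x (i, inl v).
Definition quad_coord (x : normal_vector) (i : 'I_n) (Q : quad_type) : R :=
  x (i, inr Q).

(* By pairs_up_unique, Q and Q' are determined by the other variables. *)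
Definition matching_equations (x : normal_vector) : Prop :=
  forall i F j p, glue T i F = (j, p) ->
  forall v, v != F ->
  forall Q Q', pairs_up Q v F -> pairs_up Q' (p v) (p F) ->
    tri_coord x i v + quad_coord x i Q =
    tri_coord x j (p v) + quad_coord x j Q'.

Definition quadrilateral_constraints (x : normal_vector) : Prop :=
  forall i Q Q', quad_coord x i Q != 0 -> quad_coord x i Q' != 0 -> Q = Q'.

Definition projective_solution_space : set normal_vector :=
  [set x : normal_vector |
    [/\ forall c, (0 : R) <= x c, matching_equations x & \sum_c x c = 1]].

(* Vertices are the extreme points. *)
Definition polytope_vertex (P : set normal_vector) (x : normal_vector) : Prop :=
  P x /\ forall (y z : normal_vector) (t : R), P y -> P z -> 0 < t < 1 ->
    x = t *: y + (1 - t) *: z -> y = z.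

Definition admissible_vertices : set normal_vector :=
  [set x | polytope_vertex projective_solution_space x /\
           quadrilateral_constraints x].

Definition vsupport (x : normal_vector) : {set normal_type} :=
  [set c | x c != 0]%SET.

Lemma polytope_vertex_support (x y : normal_vector) :
  polytope_vertex projective_solution_space x ->
  projective_solution_space y -> vsupport x = vsupport y -> x = y.
Proof.
move=> [[x0 xM x1] xext] [y0 yM y1] /finset.setP sxy.
pose t : R := \big[Num.min/2^-1]_(c | x c != 0) (x c : R).
have t0 : 0 < t.
  rewrite /t; elim/big_ind: _ => [|a b a0 b0|c xc].
  - by rewrite invr_gt0 ltr0n.
  - by rewrite lt_min a0.
  - by rewrite lt_def xc x0.
have t1 : t < 1.
  apply: (@le_lt_trans _ _ (2^-1)); first exact: bigmin_le_id.
  by rewrite invf_lt1 ?ltr1n.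
have s0 : 0 < 1 - t by rewrite subr_gt0.
have y_le1 c : (y c : R) <= 1.
  by rewrite -y1 (bigD1 c) //= lerDl sumr_ge0.
have tyx c : t * y c <= (x c : R).
  case: (eqVneq (x c) 0) => [xc|xc].
    have := sxy c; rewrite !inE xc eqxx => /esym/negbFE/eqP ->.
    by rewrite mulr0.
  apply: (@le_trans _ _ t); first by rewrite ler_piMr // ltW.
  exact: bigmin_le_cond.
pose z : normal_vector := [ffun c => (1 - t)^-1 * (x c - t * y c)].
have Pz : projective_solution_space z.
  split=> [c|i F j p e v vF Q Q' h h'|].
  - by rewrite ffunE mulr_ge0 ?invr_ge0 ?subr_ge0 // ltW.
  - rewrite /tri_coord /quad_coord !ffunE -!mulrDr; congr (_ * _).
    have := xM _ _ _ _ e _ vF _ _ h h'; have := yM _ _ _ _ e _ vF _ _ h h'.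
    rewrite /tri_coord /quad_coord => ey ex.
    rewrite addrACA ex -opprD -mulrDr ey mulrDr opprD addrACA.
    by [].
  - under eq_bigr do rewrite ffunE.
    rewrite -mulr_sumr sumrB -mulr_sumr x1 y1 mulr1 mulVf //.
    by rewrite gt_eqF.
have exy : x = t *: y + (1 - t) *: z.
  apply/ffunP => c; rewrite !ffunE /= /GRing.scale /= mulrA mulfV ?gt_eqF //.
  by rewrite mul1r addrC subrK.
have yz := xext y z t (And3 y0 yM y1) Pz _ exy.
by rewrite exy -yz ?t0 // -scalerDl addrC subrK scale1r.
Qed.

Lemma finite_admissible_vertices : finite_set admissible_vertices.
Proof.
rewrite -(eq_finite_set (inj_card_eq (f := vsupport) _)).
  exact: finite_finset.
move=> x y /set_mem[vx _] /set_mem[[Py _] _]; exact: polytope_vertex_support.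
Qed.

(* fset_set A enumerates A when A is finite, which holds here by the previous
   lemma. *)
Definition sigma : nat := #|` fset_set admissible_vertices|%fset.

End NormalCoordinates.

(* Main.v *)
From HB Require Import structures.
Require Import Defs.
From mathcomp Require Import all_boot all_order all_fingroup all_algebra.
From mathcomp Require Import generic_quotient finmap.
From mathcomp Require Import all_classical all_reals all_analysis.
From mathcomp Require Import ring lra zify.
From Stdlib Require Import Relation_Operators.
Import Order.TTheory GRing.Theory Num.Theory.
Import numFieldNormedType.Exports.
Require Import Defs.

(** There are triangulated 3-spheres with 11 + 2 r + 3 k tetrahedra and at least
    10 ^ k admissible vertices ([rich_family]). Taking r = 0, 1 or 2 reaches
    every size n >= 15 with 3 k >= n - 15, and 17 ^ (3/4) <= 10 because 17 ^ 3 =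
    4913, so that 10 ^ k is at least 17 ^ (n/4) up to a constant factor.

    The triangulations are grown by inserting blocks. A block is a triangulated
    ball whose boundary consists of two free triangles with a common boundary; a
    pair of glued faces is cut open and the block is put in between ([insert]).
    This changes neither the space nor the rest of the triangulation: the
    tetrahedron in front of the face is shrunk away from a lens-shaped collar of
    that face, and the block is mapped onto the collar ([insert_bijection]). The
    result is a continuous bijection from a compact space onto the old one,
    hence a homeomorphism when the old one is Hausdorff
    ([closed_manifold_transfer]). The starting point is the double of a
    tetrahedron ([double_closed_manifold]).

    In every tetrahedron the surfaces only use the quadrilateral that separates
    01 from 23. A non-negative solution of the matching equations gives a vertex
    of the projective solution space exactly when it is, up to scaling, the only
    solution whose support is contained in its own; this is [rigid], and
    [normalized_admissible] is the implication that matters. In both blocks used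
    here, each solution of the matching equations meets the two free triangles
    in the same arcs ([parallel]). So a surface extends across an inserted block
    whenever the block has a filling with the arcs prescribed on its front
    triangle, and the fillings of different blocks inserted one after the other
    at the same root face can be chosen independently. Rigidity survives an
    insertion if the filling is determined by its support and by its boundary
    arcs ([rigid_insert]).

    The page block, made of three tetrahedra, has ten such fillings with the
    same boundary arcs, three arcs around one corner and one around each of the
    others ([growth_vec]). This is where the factor 10 for three tetrahedra
    comes from. It remains to start with a rigid surface that has these arcs on
    some face: the double carries a suitable surface which is not rigid, and
    three page blocks with special fillings (ties, [tie_state]) impose the
    linear relations that make it rigid ([base_rigid]). The cone block, made of
    two tetrahedra, only adjusts the size modulo 3. *)

Set Implicit Arguments.
Unset Strict Implicit.
Unset Printing Implicit Defensive.

Local Open Scope classical_set_scope.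
Local Open Scope quotient_scope.
Local Open Scope ring_scope.

(** * Continuous bijections from a compact space *)

Section GeneralTopology.

Lemma continuous_row (R : realType) (X : topologicalType) n
    (f : X -> 'rV[R]_n) :
  (forall j, continuous (fun x => f x ord0 j)) -> continuous f.
Proof.
move=> fc x A [P Pf PA].
have : \forall y \near x, forall j, P ord0 j (f y ord0 j).
  apply: filter_forall => j; exact: fc.
apply: filterS => y Py; apply: PA => i j; rewrite ord1; exact: Py.
Qed.

Lemma set_val_continuous (X : topologicalType) (A : set X) :
  continuous (set_val : set_type A -> X).
Proof. exact: initial_continuous. Qed.

Lemma closed_of_compact (X Y : topologicalType) (h : X -> Y) (C : set X) :
  compact [set: X] -> hausdorff_space Y -> continuous h -> closed C ->
  closed (h @` C).
Proof.
move=> cX hY hc cC; apply: compact_closed => //.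
apply: continuous_compact; first exact: continuous_subspaceT.
exact: subclosed_compact cX _.
Qed.

(** Continuity of g can be tested after composing with h, because h is a closed
    map: it is a topological embedding of the compact space X. *)
Lemma continuous_lift_injection (W X Y : topologicalType) (h : X -> Y)
    (g : W -> X) :
  compact [set: X] -> hausdorff_space Y -> continuous h -> injective h ->
  continuous (h \o g) -> continuous g.
Proof.
move=> cX hY hc hI hgc; apply/continuous_closedP => C cC.
have -> : g @^-1` C = (h \o g) @^-1` (h @` C).
  apply/seteqP; split=> w /= Cw; first by exists (g w).
  by case: Cw => x Cx /hI <-.
by move/continuous_closedP: hgc; apply; apply: closed_of_compact.
Qed.

Lemma injective_hausdorff (X Y : topologicalType) (h : X -> Y) :
  hausdorff_space Y -> continuous h -> injective h -> hausdorff_space X.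
Proof.
move=> hY hc hI x y xy; apply/hI/hY => A B nA nB.
have [z [Az Bz]] := xy _ _ (hc x _ nA) (hc y _ nB).
by exists (h z).
Qed.

(** The topology of X is the one pulled back from M along h, so that X is a
    compact pseudometric space. *)
Lemma compact_injection_second_countable (R : realType) (X : topologicalType)
    (M : pseudoMetricType R) (h : X -> M) :
  compact [set: X] -> hausdorff_space M -> continuous h -> injective h ->
  @second_countable X.
Proof.
move=> cX hM hc hI.
have [[x0 _]|X0] := pselect (exists x : X, True); last first.
  exists set0; first exact: countable0.
  by split=> // x; case: X0; exists x.
pose W := initial_topology h.
pose W' : pseudoPMetricType R :=
  HB.pack_for (pseudoPMetricType R) (W : Type) (PseudoMetric.on W)
    (isPointed.Build _ (x0 : W)).
have cid1 : continuous (id : X -> W).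
  exact: (continuous_comp_initial (w := h)).
have cid2 : continuous (id : W -> X).
  apply: (continuous_lift_injection cX hM hc hI); exact: initial_continuous.
have cW : compact [set: W'].
  have -> : [set: W'] = (id : X -> W') @` [set: X].
    by apply/seteqP; split=> x // _; exists x.
  by apply: continuous_compact => //; exact: continuous_subspaceT.
have [B cB [oB bB]] := compact_second_countable cW.
exists B => //; split.
  move=> b /oB ob; exact: (open_comp (f := id : X -> W')).
move=> x V nV; have := bB x V; apply.
exact: (cid2 x V).
Qed.

End GeneralTopology.

Section Transfer.
Variables (X Y : topologicalType) (h : X -> Y).
Hypothesis cX : compact [set: X].
Hypothesis hc : continuous h.
Hypothesis hI : injective h.
Hypothesis hS : forall y, exists x, h x = y.

(** The inverse k of h is continuous by [continuous_lift_injection], so that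
    charts and countable bases can be carried over. *)
Lemma closed_manifold_transfer (R : realType) d :
  closed_manifold R d Y -> closed_manifold R d X.
Proof.
move=> [hY [B cB [oB bB]] lY _].
have [k hk] := choice hS.
have kh : cancel h k by move=> x; apply: hI; rewrite hk.
have kc : continuous k.
  apply: (continuous_lift_injection cX hY hc hI).
  have -> : h \o k = id by apply: boolp.funext => y /=; rewrite hk.
  by move=> y.
split=> //.
- exact: injective_hausdorff hY hc hI.
- exists [set h @^-1` b | b in B]; first exact: card_le_trans (card_image_le _ _) cB.
  split; first by move=> _ [b Bb <-]; apply: open_comp => //; exact: oB.
  move=> x V nV.
  have [|b [Bb bx bV]] := bB (h x) (k @^-1` V).
    by apply: kc; rewrite kh.
  exists (h @^-1` b); first by split=> //; exists b.
  by move=> z /= /bV /=; rewrite kh.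
- move=> x; have [U [V [oU Uhx oV [f [g [fc gc fg gf]]]]]] := lY (h x).
  exists (h @^-1` U), V; split=> //; first exact: open_comp.
  have hU (z : set_type (h @^-1` U)) : h (set_val z) \in U.
    by apply/mem_set; exact: (set_valP z).
  have kU (u : set_type U) : k (set_val u) \in h @^-1` U.
    by apply/mem_set; rewrite /= hk; exact: set_valP.
  pose a (z : set_type (h @^-1` U)) : set_type U := SigSub (hU z).
  pose b (u : set_type U) : set_type (h @^-1` U) := SigSub (kU u).
  have ac : continuous a.
    apply: continuous_comp_initial => z.
    apply: (@continuous_comp _ _ _ set_val h); last exact: hc.
    exact: set_val_continuous.
  have bc : continuous b.
    apply: continuous_comp_initial => z.
    apply: (@continuous_comp _ _ _ set_val k); last exact: kc.
    exact: set_val_continuous.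
  exists (f \o a), (b \o g); split.
  - by move=> z; apply: continuous_comp; [exact: ac | exact: fc].
  - by move=> z; apply: continuous_comp; [exact: gc | exact: bc].
  - move=> z /=; rewrite fg; apply: val_inj => /=; exact: kh.
  - move=> z /=; rewrite -[RHS]gf; congr f; apply: val_inj => /=; exact: hk.
Qed.

End Transfer.

(** * Realizations of gluings *)

Section Simplex.
Variable R : realType.

Lemma coord_row_continuous n (j : 'I_n) :
  continuous (fun x : 'rV[R]_n => x ord0 j).
Proof. exact: coord_continuous. Qed.

Lemma continuous_bigsum (X : topologicalType) (I : Type) (r : seq I)
    (P : pred I) (F : I -> X -> R) :
  (forall i, continuous (F i)) -> continuous (fun x => \sum_(i <- r | P i) F i x).
Proof.
move=> Fc x; elim: r => [|i r IH].
  under eq_fun do rewrite big_nil; exact: cvg_cst.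
under eq_fun do rewrite big_cons.
by case: ifP => // _; apply: cvgD => //; exact: Fc.
Qed.

Lemma simplex3_le1 (x : 'rV[R]_4) v : simplex3 x -> x ord0 v <= 1.
Proof.
move=> [x0 x1]; rewrite -x1 (bigD1 v) //= lerDl sumr_ge0 // => u _; exact: x0.
Qed.

Lemma simplex3_compact : compact (@simplex3 R).
Proof.
apply: bounded_closed_compact.
  exists 1; split; first exact: num_real.
  move=> M M1 x sx; rewrite /= /Num.norm /= mx_normrE; apply/bigmax_leP; split.
    exact: le_trans (ltW M1).
  move=> [i j] _ /=; rewrite ord1 ger0_norm; last by case: sx.
  exact: le_trans (simplex3_le1 _ sx) (ltW M1).
have -> : @simplex3 R = (\bigcap_(v : 'I_4) [set x : 'rV[R]_4 | 0 <= x ord0 v]) `&`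
    [set x : 'rV[R]_4 | \sum_v x ord0 v = 1].
  apply/seteqP; split=> x /= [x0 x1]; split=> // v.
    by move=> _; exact: x0.
  exact: (x0 v).
apply: closedI.
  apply: closed_bigI => v _.
  apply: (@closed_comp _ _ (fun x : 'rV[R]_4 => x ord0 v) [set y : R | 0 <= y]).
    by move=> x _; exact: coord_row_continuous.
  exact: closed_ge.
apply: (@closed_comp _ _ (fun x : 'rV[R]_4 => \sum_v x ord0 v) [set y : R | y = 1]).
  move=> x _; apply: continuous_bigsum => v; exact: coord_row_continuous.
exact: closed_eq.
Qed.

End Simplex.

Lemma set_type_compact (X : topologicalType) (A : set X) :
  compact A -> compact [set: set_type A].
Proof.
move=> cA F PF _.
have [|p [Ap cp]] := cA (set_val @ F) _.
  apply: (@filterS _ F _ setT); last exact: filterT.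
  by move=> x _; exact: set_valP.
exists (SigSub (mem_set Ap)); split=> // B C FB.
move=> [_ [[W oW <-] Wp] WC].
have FB' : (set_val @ F) (set_val @` B).
  by apply: (@filterS _ F _ B) => // x Bx; exists x.
have [z [[y By <-] Wy]] := cp _ W FB' (open_nbhs_nbhs (conj oW Wp)).
by exists y; split=> //; exact: WC.
Qed.

Section Realization.
Variables (R : realType) (n : nat) (T : gluing n).
Local Notation tet := (tetrahedra R n).

Definition rclass (a : tet) : realization R T := \pi_(realization R T) a.

Lemma rclassP (a b : tet) :
  rclass a = rclass b <-> clos_refl_sym_trans tet (glued T) a b.
Proof.
split; first by move/eqmodP => /asboolP.
by move=> ab; apply/eqmodP/asboolP.
Qed.

Lemma glued_rclass (a b : tet) : glued T a b -> rclass a = rclass b.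
Proof. by move=> ab; apply/rclassP/rst_step. Qed.

Lemma rclass_continuous : continuous rclass.
Proof. exact: pi_continuous. Qed.

Lemma rclass_surj (x : realization R T) : exists a, rclass a = x.
Proof. by exists (repr x); exact: reprK. Qed.

Lemma rclass_ind (Z : Type) (g : tet -> Z) :
  (forall a b, glued T a b -> g a = g b) ->
  forall a b, rclass a = rclass b -> g a = g b.
Proof.
move=> gg a b /rclassP; elim=> //; first by move=> x y z _ -> _ ->.
Qed.

Lemma realization_lift (Z : topologicalType) (g : tet -> Z) :
  continuous g -> (forall a b, glued T a b -> g a = g b) ->
  exists2 G : realization R T -> Z,
    continuous G & forall a, G (rclass a) = g a.
Proof.
move=> gc gg; exists (g \o repr).
  apply: repr_comp_continuous => // a b /eqP ab; apply/eqP.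
  exact: rclass_ind gg _ _ ab.
move=> a /=; apply: (rclass_ind gg); exact: reprK.
Qed.

Lemma tetrahedra_compact : compact [set: tet].
Proof.
apply: sigT_compact => [|i]; [exact: finite_finset|]; apply: set_type_compact; exact: simplex3_compact.
Qed.

Lemma realization_compact : compact [set: realization R T].
Proof.
have -> : [set: realization R T] = rclass @` [set: tet].
  by apply/seteqP; split=> x // _; have [a <-] := rclass_surj x; exists a.
apply: continuous_compact; last exact: tetrahedra_compact.
exact/continuous_subspaceT/rclass_continuous.
Qed.

End Realization.

(** To compare two realizations it suffices to have maps psi and theta between
    the disjoint unions of tetrahedra that respect the gluings and are mutually
    inverse up to gluing. Only psi has to be continuous: theta is allowed to
    make arbitrary choices. *)
Lemma realization_bijection (R : realType) n n' (T : gluing n) (T' : gluing n')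
    (psi : tetrahedra R n' -> tetrahedra R n)
    (theta : tetrahedra R n -> tetrahedra R n') :
  continuous (rclass T \o psi) ->
  (forall a b, glued T' a b -> rclass T (psi a) = rclass T (psi b)) ->
  (forall p q, glued T p q -> rclass T' (theta p) = rclass T' (theta q)) ->
  (forall p, rclass T (psi (theta p)) = rclass T p) ->
  (forall a, rclass T' (theta (psi a)) = rclass T' a) ->
  exists h : realization R T' -> realization R T,
    [/\ continuous h, injective h & forall y, exists x, h x = y].
Proof.
move=> psic psig thetag psiK thetaK.
have [h hc hE] := realization_lift psic psig.
exists h; split=> //.
- move=> x y; have [a <-] := rclass_surj x; have [b <-] := rclass_surj y.
  rewrite !hE /= => ab; rewrite -(thetaK a) -(thetaK b).
  exact: (rclass_ind thetag).
- move=> y; have [p <-] := rclass_surj y; exists (rclass T' (theta p)).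
  by rewrite hE /= psiK.
Qed.

(** * Inserting a block into a face *)

Definition o0 : 'I_4 := @Ordinal 4 0 isT.
Definition o1 : 'I_4 := @Ordinal 4 1 isT.
Definition o2 : 'I_4 := @Ordinal 4 2 isT.
Definition o3 : 'I_4 := @Ordinal 4 3 isT.

Lemma ord4_ind (P : 'I_4 -> Prop) : P o0 -> P o1 -> P o2 -> P o3 -> forall v, P v.
Proof.
move=> P0 P1 P2 P3 [[|[|[|[|v]]]] lt4] //.
- by rewrite (_ : Ordinal lt4 = o0) //; apply: val_inj.
- by rewrite (_ : Ordinal lt4 = o1) //; apply: val_inj.
- by rewrite (_ : Ordinal lt4 = o2) //; apply: val_inj.
- by rewrite (_ : Ordinal lt4 = o3) //; apply: val_inj.
Qed.

(** A triangulated ball with two free triangles, the face 1 of bfront and the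
    face btau 1 of bback. The vertex v of the front triangle lies at the vertex
    btau v of the back triangle, since the two triangles have the same boundary.
    All other faces are glued in pairs by bglue, whose values at the two free
    faces are meaningless. *)
Record block := Block {
  bsize : nat ;
  bglue : 'I_bsize -> 'I_4 -> 'I_bsize * 'S_4 ;
  bfront : 'I_bsize ;
  bback : 'I_bsize ;
  btau : 'S_4 ;
  bfree : (bfront, o1) <> (bback, btau o1) ;
  binner := fun k G => (k, G) != (bfront, o1) /\ (k, G) != (bback, btau o1) ;
  bglue_inner : forall k G k' q, binner k G -> bglue k G = (k', q) ->
    binner k' (q G) ;
  bglue_sym : forall k G k' q, binner k G -> bglue k G = (k', q) ->
    bglue k' (q G) = (k, q^-1%g) ;
  bglue_neq : forall k G k' q, binner k G -> bglue k G = (k', q) ->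
    (k', q G) <> (k, G) }.

Section Insertion.
Variables (n : nat) (T : gluing n) (B : block) (i : 'I_n) (a : 'S_4).
Local Notation m := (bsize B).

(** The block is inserted at face F of tetrahedron i; a carries F to the front
    triangle of the block, hence sends F to 1. *)
Definition ins_face : 'I_4 := a^-1%g o1.
Local Notation F := ins_face.
Local Notation j := (glue T i F).1.
Local Notation p := (glue T i F).2.

(** The gluing from the other side of the opened pair of faces to the back
    triangle: the way back to face F, then a, then through the block by btau.
    With this choice a block of thickness zero would leave the old gluing p
    unchanged. *)
Definition ins_back : 'S_4 := (p^-1 * (a * btau B))%g.

Definition ins_glue (s : 'I_n + 'I_m) (G : 'I_4) : ('I_n + 'I_m) * 'S_4 :=
  match s with
  | inl l => if (l, G) == (i, F) then (inr (bfront B), a)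
             else if (l, G) == (j, p F) then (inr (bback B), ins_back)
             else (inl (glue T l G).1, (glue T l G).2)
  | inr k => if (k, G) == (bfront B, o1) then (inl i, a^-1%g)
             else if (k, G) == (bback B, btau B o1) then (inl j, ins_back^-1%g)
             else (inr (bglue k G).1, (bglue k G).2)
  end.

Lemma ins_faceK : a F = o1.
Proof. by rewrite /ins_face permKV. Qed.

Lemma ins_backE v : ins_back (p v) = btau B (a v).
Proof. by rewrite /ins_back !permM permK. Qed.

Let glue_ij : glue T i F = (j, p).
Proof. by case: (glue T i F). Qed.

Let ji_neq : ((j, p F) == (i, F)) = false.
Proof. by apply/eqP; apply: (glue_neq glue_ij). Qed.

Let back_neq : ((bback B, btau B o1) == (bfront B, o1)) = false.
Proof. by apply/eqP => /esym; exact: bfree. Qed.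

Lemma ins_regular l G : (l, G) != (i, F) -> (l, G) != (j, p F) ->
  ((glue T l G).1, (glue T l G).2 G) != (i, F) /\
  ((glue T l G).1, (glue T l G).2 G) != (j, p F).
Proof.
move=> li lj; case e : (glue T l G) => [l' q] /=; have e' := glue_sym e.
split; apply/eqP => -[El Eq].
  move: lj; rewrite El Eq in e'; move/eqP; apply.
  by rewrite e' /= -Eq permK.
move: li => /eqP; apply; have e'' := glue_sym glue_ij.
move: e'; rewrite El Eq e'' => -[<- /invg_inj pq].
by congr (_, _); apply: (@perm_inj _ q); rewrite Eq -pq.
Qed.

Lemma ins_sym s G s' q : ins_glue s G = (s', q) -> ins_glue s' (q G) = (s, q^-1%g).
Proof.
case: s => [l|k] /=.
  case: eqVneq => [[-> ->] [<- <-]|li].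
    by rewrite /= ins_faceK eqxx.
  case: eqVneq => [[-> ->] [<- <-]|lj].
    by rewrite /= ins_backE ins_faceK back_neq eqxx.
  have [ri rj] := ins_regular li lj.
  case=> <- <- /=; rewrite (negbTE ri) (negbTE rj).
  by case e : (glue T l G) => [l' q'] /=; rewrite (glue_sym e).
case: eqVneq => [[-> ->] [<- <-]|kf].
  by rewrite /= eqxx invgK.
case: eqVneq => [[-> ->] [<- <-]|kb].
  by rewrite /= -{1 2 3}ins_faceK -ins_backE permK ji_neq eqxx invgK.
case=> <- <- /=; case e : (bglue k G) => [k' q'] /=.
have [/negbTE -> /negbTE ->] := bglue_inner (conj kf kb) e.
by rewrite (bglue_sym (conj kf kb) e).
Qed.

Lemma ins_neq s G s' q : ins_glue s G = (s', q) -> (s', q G) <> (s, G).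
Proof.
case: s => [l|k] /=.
  case: eqVneq => [[-> ->] [<- <-]|li]; first by case.
  case: eqVneq => [[-> ->] [<- <-]|lj]; first by case.
  case=> <- <- [El Eq].
  by case e : (glue T l G) El Eq => [l' q'] /= El Eq; apply: (glue_neq e); rewrite El Eq.
case: eqVneq => [[-> ->] [<- <-]|kf]; first by case.
case: eqVneq => [[-> ->] [<- <-]|kb]; first by case.
case=> <- <- [El Eq].
case e : (bglue k G) El Eq => [k' q'] /= El Eq.
by apply: (bglue_neq (conj kf kb) e); rewrite El Eq.
Qed.

Definition insert_glue (u : 'I_(n + m)) (G : 'I_4) : 'I_(n + m) * 'S_4 :=
  (unsplit (ins_glue (fintype.split u) G).1, (ins_glue (fintype.split u) G).2).

Lemma insert_glue_sym u G u' q :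
  insert_glue u G = (u', q) -> insert_glue u' (q G) = (u, q^-1%g).
Proof.
rewrite /insert_glue => -[<- <-]; rewrite unsplitK.
case e : (ins_glue (fintype.split u) G) => [s' q'] /=.
by rewrite (ins_sym e) /= splitK.
Qed.

Lemma insert_glue_neq u G u' q : insert_glue u G = (u', q) -> (u', q G) <> (u, G).
Proof.
rewrite /insert_glue => -[<- <-] [Eu Eq].
case e : (ins_glue (fintype.split u) G) Eu Eq => [s' q'] /= Eu Eq.
by apply: (ins_neq e); rewrite -Eu unsplitK Eq.
Qed.

Definition insert : gluing (n + m) := Gluing insert_glue_sym insert_glue_neq.

Lemma insertP u G v q : glue insert u G = (v, q) <->
  ins_glue (fintype.split u) G = (fintype.split v, q).
Proof.
rewrite /= /insert_glue; split=> [[<- <-]|->]; rewrite ?unsplitK ?splitK //.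
by case: (ins_glue _ _).
Qed.

End Insertion.

(** * Points of the standard tetrahedron *)

Lemma cont_comp (X Y Z : topologicalType) (f : X -> Y) (g : Y -> Z) :
  continuous f -> continuous g -> continuous (g \o f).
Proof. by move=> fc gc x; apply: continuous_comp; [exact: fc|exact: gc]. Qed.

Section Points.
Variable R : realType.

Definition pnt := set_type (@simplex3 R).
Definition bc (x : pnt) (v : 'I_4) : R := set_val x ord0 v.

Lemma bc_ge0 x v : 0 <= bc x v. Proof. by case: (set_valP x) => + _; apply. Qed.

Lemma sum_ord4 (f : 'I_4 -> R) : \sum_v f v = f o0 + f o1 + f o2 + f o3.
Proof.
rewrite !big_ord_recl big_ord0 addr0 !addrA.
by congr (f _ + f _ + f _ + f _); apply: val_inj.
Qed.

Lemma bc_sum x : bc x o0 + bc x o1 + bc x o2 + bc x o3 = 1.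
Proof. by have [_ <-] := set_valP x; rewrite sum_ord4. Qed.

Lemma pnt_eq (x y : pnt) : (forall v, bc x v = bc y v) -> x = y.
Proof.
by move=> xy; apply: val_inj; apply/rowP => v; exact: xy.
Qed.

Definition row4 (x0 x1 x2 x3 : R) : 'rV[R]_4 :=
  \row_v nth 0 [:: x0; x1; x2; x3] v.

Definition vertex0 : pnt.
Proof.
exists (row4 1 0 0 0); apply/mem_set; split; last first.
  by rewrite sum_ord4 !mxE /= !addr0.
by apply: ord4_ind; rewrite mxE.
Defined.

(** An arbitrary vertex is returned unless the four numbers are barycentric
    coordinates; see [mkptE]. *)
Definition mkpt (x0 x1 x2 x3 : R) : pnt := insubd vertex0 (row4 x0 x1 x2 x3).

Lemma mkptE x0 x1 x2 x3 :
  0 <= x0 -> 0 <= x1 -> 0 <= x2 -> 0 <= x3 -> x0 + x1 + x2 + x3 = 1 ->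
  [/\ bc (mkpt x0 x1 x2 x3) o0 = x0, bc (mkpt x0 x1 x2 x3) o1 = x1,
      bc (mkpt x0 x1 x2 x3) o2 = x2 & bc (mkpt x0 x1 x2 x3) o3 = x3].
Proof.
move=> h0 h1 h2 h3 hs.
have s : row4 x0 x1 x2 x3 \in @simplex3 R.
  apply/mem_set; split; first by apply: ord4_ind; rewrite mxE.
  by rewrite sum_ord4 !mxE.
have E v : bc (mkpt x0 x1 x2 x3) v = row4 x0 x1 x2 x3 ord0 v.
  by rewrite /bc /mkpt set_valE /= insubdK.
by rewrite !E !mxE.
Qed.

Lemma bc_continuous v : continuous (bc ^~ v).
Proof.
move=> x; apply: (@continuous_comp _ _ _ set_val (fun y : 'rV[R]_4 => y ord0 v)).
  exact: set_val_continuous.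
exact: coord_row_continuous.
Qed.

Lemma continuous_pnt (X : topologicalType) (f : X -> pnt) :
  (forall v, continuous (fun x => bc (f x) v)) -> continuous f.
Proof.
by move=> fc; apply: continuous_comp_initial; apply: continuous_row.
Qed.

Lemma permute_subproof (s : 'S_4) (x : pnt) :
  \row_v (bc x (s v)) \in @simplex3 R.
Proof.
apply/mem_set; split; first by move=> v; rewrite mxE bc_ge0.
have [_ <-] := set_valP x.
rewrite [RHS](reindex_inj (@perm_inj _ s)) /=.
by apply: eq_bigr => v _; rewrite mxE.
Qed.
Definition permute (s : 'S_4) (x : pnt) : pnt := SigSub (permute_subproof s x).

Lemma bc_permute s x v : bc (permute s x) v = bc x (s v).
Proof. by rewrite /bc /permute set_valE /= mxE. Qed.

Lemma permuteK s : cancel (permute s) (permute s^-1%g).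
Proof. by move=> x; apply: pnt_eq => v; rewrite !bc_permute permKV. Qed.

Lemma permuteKV s : cancel (permute s^-1%g) (permute s).
Proof. by move=> x; apply: pnt_eq => v; rewrite !bc_permute permK. Qed.

Lemma permute_continuous s : continuous (permute s).
Proof.
apply: continuous_pnt => v; under eq_fun do rewrite bc_permute.
exact: bc_continuous.
Qed.

Section ContinuousReal.
Variable X : topologicalType.
Implicit Types f g : X -> R.

Lemma cont_cst (c : R) : continuous (fun _ : X => c).
Proof. by move=> x; exact: cvg_cst. Qed.
Lemma contD f g : continuous f -> continuous g -> continuous (fun x => f x + g x).
Proof. by move=> fc gc x; apply: cvgD; [exact: fc|exact: gc]. Qed.
Lemma contB f g : continuous f -> continuous g -> continuous (fun x => f x - g x).
Proof. by move=> fc gc x; apply: cvgB; [exact: fc|exact: gc]. Qed.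
Lemma contM f g : continuous f -> continuous g -> continuous (fun x => f x * g x).
Proof. by move=> fc gc x; apply: cvgM; [exact: fc|exact: gc]. Qed.
Lemma contN f : continuous f -> continuous (fun x => - f x).
Proof. by move=> fc x; apply: cvgN; exact: fc. Qed.
Lemma cont_norm f : continuous f -> continuous (fun x => `|f x|).
Proof. by move=> fc x; apply: cvg_norm; exact: fc. Qed.
Lemma cont_min f g :
  continuous f -> continuous g -> continuous (fun x => Num.min (f x) (g x)).
Proof. by move=> fc gc x; apply: continuous_min; [exact: fc|exact: gc]. Qed.
Lemma cont_max f g :
  continuous f -> continuous g -> continuous (fun x => Num.max (f x) (g x)).
Proof. by move=> fc gc x; apply: continuous_max; [exact: fc|exact: gc]. Qed.

End ContinuousReal.

Lemma min3P (x y z : R) : let m := Num.min x (Num.min y z) in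
  [/\ m <= x, m <= y, m <= z & [\/ m = x, m = y | m = z]].
Proof.
rewrite /=; case: (leP y z) => yz; case: (leP x _) => xy; split=> //;
  try (by [apply: Or31|apply: Or32|apply: Or33]); lra.
Qed.

Lemma min3_eq (x y z m : R) : m <= x -> m <= y -> m <= z ->
  [\/ m = x, m = y | m = z] -> Num.min x (Num.min y z) = m.
Proof.
move=> mx my mz M; have /= [lx ly lz L] := min3P x y z.
move: lx ly lz L; set k := Num.min x _ => lx ly lz L.
by case: M => M; case: L => L; lra.
Qed.

End Points.

(** * The collar of a face *)

Section Collar.
Variable R : realType.
Local Notation pnt := (pnt R).

(** Positive exactly off the three faces other than face 1. The collar of face 1
    is the lens where the coordinate of vertex 1 is at most 3 depth; its two
    sides, face 1 itself and the surface where equality holds, meet along the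
    boundary of face 1. *)
Definition depth (x : pnt) : R :=
  Num.min (bc x o0) (Num.min (bc x o2) (bc x o3)).

Lemma depthP x : [/\ depth x <= bc x o0, depth x <= bc x o2, depth x <= bc x o3 &
  [\/ depth x = bc x o0, depth x = bc x o2 | depth x = bc x o3]].
Proof. exact: min3P. Qed.

Lemma depth_ge0 x : 0 <= depth x.
Proof. by have [_ _ _ []->] := depthP x; rewrite bc_ge0. Qed.

Lemma depth_eq x m : m <= bc x o0 -> m <= bc x o2 -> m <= bc x o3 ->
  [\/ m = bc x o0, m = bc x o2 | m = bc x o3] -> depth x = m.
Proof. exact: min3_eq. Qed.

Lemma depth_face0 x v : v != o1 -> bc x v = 0 -> depth x = 0.
Proof.
move=> v1 xv; apply/eqP; rewrite eq_le depth_ge0 andbT -xv.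
have [x0 x2 x3 _] := depthP x; move: v v1 {xv}.
by apply: ord4_ind.
Qed.

Lemma depth_continuous : continuous depth.
Proof.
by apply: cont_min; [|apply: cont_min]; exact: bc_continuous.
Qed.

(** Moves every point in the direction from the centre of face 1 to vertex 1,
    onto the complement of the collar. The coefficients keep the sum of the
    coordinates and halve the depth, so that face 1 goes to the surface x1 = 3
    depth. *)
Definition shrink (x : pnt) : pnt :=
  mkpt (bc x o0 - depth x / 2) (bc x o1 + 3 / 2 * depth x)
       (bc x o2 - depth x / 2) (bc x o3 - depth x / 2).

Lemma shrinkE x : [/\ bc (shrink x) o0 = bc x o0 - depth x / 2,
  bc (shrink x) o1 = bc x o1 + 3 / 2 * depth x,
  bc (shrink x) o2 = bc x o2 - depth x / 2 & bc (shrink x) o3 = bc x o3 - depth x / 2].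
Proof.
have [x0 x2 x3 _] := depthP x; have m0 := depth_ge0 x; have xs := bc_sum x.
have x1 := bc_ge0 x o1.
by apply: mkptE; lra.
Qed.

Lemma depth_shrink x : depth (shrink x) = depth x / 2.
Proof.
have [x0 x2 x3 M] := depthP x; have [e0 e1 e2 e3] := shrinkE x.
apply: depth_eq; rewrite ?e0 ?e2 ?e3; [lra|lra|lra|].
by case: M => M; [apply: Or31|apply: Or32|apply: Or33]; lra.
Qed.

Lemma shrink_out x : 3 * depth (shrink x) <= bc (shrink x) o1.
Proof.
have [_ -> _ _] := shrinkE x; rewrite depth_shrink; have := bc_ge0 x o1; lra.
Qed.

Lemma shrink_id x : depth x = 0 -> shrink x = x.
Proof.
move=> m0; have [e0 e1 e2 e3] := shrinkE x; rewrite m0 in e0 e1 e2 e3.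
by apply: pnt_eq; apply: ord4_ind; rewrite ?e0 ?e1 ?e2 ?e3; lra.
Qed.

Lemma shrink_continuous : continuous shrink.
Proof.
apply: continuous_pnt; apply: ord4_ind.
- rewrite (_ : (fun x => _) = (fun x => bc x o0 - depth x * 2^-1)).
    by apply: contB; [exact: bc_continuous|apply: contM; [exact: depth_continuous|exact: cont_cst]].
  by apply: boolp.funext => x; have [-> _ _ _] := shrinkE x.
- rewrite (_ : (fun x => _) = (fun x => bc x o1 + 3 / 2 * depth x)).
    by apply: contD; [exact: bc_continuous|apply: contM; [exact: cont_cst|exact: depth_continuous]].
  by apply: boolp.funext => x; have [_ -> _ _] := shrinkE x.
- rewrite (_ : (fun x => _) = (fun x => bc x o2 - depth x * 2^-1)).
    by apply: contB; [exact: bc_continuous|apply: contM; [exact: depth_continuous|exact: cont_cst]].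
  by apply: boolp.funext => x; have [_ _ -> _] := shrinkE x.
- rewrite (_ : (fun x => _) = (fun x => bc x o3 - depth x * 2^-1)).
    by apply: contB; [exact: bc_continuous|apply: contM; [exact: depth_continuous|exact: cont_cst]].
  by apply: boolp.funext => x; have [_ _ _ ->] := shrinkE x.
Qed.

Definition unshrink (x : pnt) : pnt :=
  mkpt (bc x o0 + depth x) (bc x o1 - 3 * depth x) (bc x o2 + depth x) (bc x o3 + depth x).

Lemma unshrinkE x : 3 * depth x <= bc x o1 -> [/\ bc (unshrink x) o0 = bc x o0 + depth x,
  bc (unshrink x) o1 = bc x o1 - 3 * depth x,
  bc (unshrink x) o2 = bc x o2 + depth x & bc (unshrink x) o3 = bc x o3 + depth x].
Proof.
move=> x1; have m0 := depth_ge0 x; have xs := bc_sum x.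
have x0 := bc_ge0 x o0; have x2 := bc_ge0 x o2; have x3 := bc_ge0 x o3.
by apply: mkptE; lra.
Qed.

Lemma depth_unshrink x : 3 * depth x <= bc x o1 -> depth (unshrink x) = 2 * depth x.
Proof.
move=> x1; have [x0 x2 x3 M] := depthP x; have [e0 e1 e2 e3] := unshrinkE x1.
apply: depth_eq; rewrite ?e0 ?e2 ?e3; [lra|lra|lra|].
by case: M => M; [apply: Or31|apply: Or32|apply: Or33]; lra.
Qed.

Lemma unshrinkK x : 3 * depth x <= bc x o1 -> shrink (unshrink x) = x.
Proof.
move=> x1; have [e0 e1 e2 e3] := unshrinkE x1.
have [f0 f1 f2 f3] := shrinkE (unshrink x); have mE := depth_unshrink x1.
by apply: pnt_eq; apply: ord4_ind; rewrite ?f0 ?f1 ?f2 ?f3 mE ?e0 ?e1 ?e2 ?e3; lra.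
Qed.

Lemma shrinkK x : unshrink (shrink x) = x.
Proof.
have [e0 e1 e2 e3] := unshrinkE (shrink_out x).
have [f0 f1 f2 f3] := shrinkE x; have mE := depth_shrink x.
by apply: pnt_eq; apply: ord4_ind; rewrite ?e0 ?e1 ?e2 ?e3 mE ?f0 ?f1 ?f2 ?f3; lra.
Qed.

End Collar.

(** * Inserting a block does not change the space *)

Section BlockMap.
Variables (R : realType) (B : block).
Local Notation pnt := (pnt R).

Definition bstep (c d : 'I_(bsize B) * pnt) : Prop :=
  exists G q, [/\ binner c.1 G, bglue c.1 G = (d.1, q), bc c.2 G = 0 &
    forall v, bc d.2 (q v) = bc c.2 v].

Definition bequiv := clos_refl_sym_trans _ bstep.

(** An identification of the realization of the block with the collar of face 1
    of a tetrahedron. The front triangle must go to the inner side of the collar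
    in the way in which [shrink] moves face 1, and the back triangle to face 1
    itself, with its vertices matched by btau. *)
Record block_map := BlockMap {
  bmap : 'I_(bsize B) -> pnt -> pnt ;
  bmap_continuous : forall k, continuous (bmap k) ;
  bmap_collar : forall k w, bc (bmap k w) o1 <= 3 * depth (bmap k w) ;
  bmap_front : forall w, bc w o1 = 0 -> bmap (bfront B) w = shrink w ;
  bmap_back : forall w, bc w (btau B o1) = 0 ->
    bmap (bback B) w = permute (btau B) w ;
  bmap_inner : forall c d, bstep c d -> bmap c.1 c.2 = bmap d.1 d.2 ;
  bmap_surj : forall z, bc z o1 <= 3 * depth z ->
    exists c, bmap c.1 c.2 = z ;
  bmap_inj : forall c d, bmap c.1 c.2 = bmap d.1 d.2 -> bequiv c d }.

End BlockMap.

Section InsertTopology.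
Variables (R : realType) (n : nat) (T : gluing n) (B : block) (i : 'I_n).
Variables (a : 'S_4) (M : block_map R B).
Local Notation m := (bsize B).
Local Notation pnt := (pnt R).
Local Notation T' := (insert T B i a).
Local Notation F := (ins_face a).
Local Notation j := (glue T i F).1.
Local Notation p := (glue T i F).2.

Definition mkT (l : 'I_n) (x : pnt) : tetrahedra R n := existT _ l x.
Definition mkI (s : 'I_n + 'I_m) (x : pnt) : tetrahedra R (n + m) :=
  existT _ (unsplit s) x.

Lemma mkI_surj (c : tetrahedra R (n + m)) : exists s x, c = mkI s x.
Proof.
by case: c => u x; exists (fintype.split u), x; rewrite /mkI splitK.
Qed.

Lemma glued_mkT l x l' y : glued T (mkT l x) (mkT l' y) <->
  exists G q, [/\ glue T l G = (l', q), bc x G = 0 & forall v, bc y (q v) = bc x v].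
Proof. by []. Qed.

Lemma glued_mkI s x s' y : glued T' (mkI s x) (mkI s' y) <->
  exists G q, [/\ ins_glue T i a s G = (s', q), bc x G = 0 &
    forall v, bc y (q v) = bc x v].
Proof.
split=> -[G [q [e xG yx]]]; exists G, q; split=> //.
  by move/insertP: e; rewrite !unsplitK.
by apply/insertP; rewrite !unsplitK.
Qed.

(** Tetrahedron i is shrunk away from the collar of its face F, the block fills
    that collar, and everything else stays in place. The conjugation by a turns
    face F into face 1. *)
Definition fill_at (s : 'I_n + 'I_m) (x : pnt) : tetrahedra R n :=
  match s with
  | inl l => if l == i then mkT i (permute a (shrink (permute a^-1%g x)))
             else mkT l x
  | inr k => mkT i (permute a (bmap M k x))
  end.

Definition fill (c : tetrahedra R (n + m)) : tetrahedra R n :=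
  fill_at (fintype.split (projT1 c)) (projT2 c).

Lemma fill_mkI s x : fill (mkI s x) = fill_at s x.
Proof. by rewrite /fill /= unsplitK. Qed.

Lemma fill_continuous : continuous fill.
Proof.
apply: (@sigT_continuous _ _ _ (fun u => fill_at (fintype.split u))) => u.
case: (fintype.split u) => [l|k]; rewrite /fill_at.
  case: (l == i); last exact: (@existT_continuous _ (fun _ : 'I_n => pnt) l).
  have c1 := cont_comp (@permute_continuous R a^-1%g) (@shrink_continuous R).
  have c2 := cont_comp c1 (@permute_continuous R a).
  exact: (cont_comp c2 (@existT_continuous _ (fun _ : 'I_n => pnt) i)).
have c1 := cont_comp (@bmap_continuous _ _ M k) (@permute_continuous R a).
exact: (cont_comp c1 (@existT_continuous _ (fun _ : 'I_n => pnt) i)).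
Qed.

Definition rT (l : 'I_n) (x : pnt) := rclass T (mkT l x).
Definition rI (s : 'I_n + 'I_m) (x : pnt) := rclass T' (mkI s x).

Lemma rT_glue l x l' y G q : glue T l G = (l', q) -> bc x G = 0 ->
  (forall v, bc y (q v) = bc x v) -> rT l x = rT l' y.
Proof. by move=> e xG yx; apply/glued_rclass/glued_mkT; exists G, q. Qed.

Lemma rI_glue s x s' y G q : ins_glue T i a s G = (s', q) -> bc x G = 0 ->
  (forall v, bc y (q v) = bc x v) -> rI s x = rI s' y.
Proof. by move=> e xG yx; apply/glued_rclass/glued_mkI; exists G, q. Qed.

Let glue_ij : glue T i F = (j, p).
Proof. by case: (glue T i F). Qed.

Let ji_neq : (j, p F) <> (i, F).
Proof. exact: (glue_neq glue_ij). Qed.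

(** The faces other than F consist of points of depth zero, which shrinking does
    not move. *)
Lemma fill_face l x G : (l, G) != (i, F) -> bc x G = 0 ->
  fill_at (inl l) x = mkT l x.
Proof.
move=> lG xG /=; case: (eqVneq l i) lG => [->|//] lG.
rewrite shrink_id ?permuteKV //; apply: (@depth_face0 _ _ (a G)).
  by apply: contra_neq lG => aG; rewrite /ins_face -aG permK.
by rewrite bc_permute permK.
Qed.

Lemma rI_bequiv c d : bequiv c d -> rI (inr c.1) c.2 = rI (inr d.1) d.2.
Proof.
elim=> [{}c {}d [G [q [[/negbTE f0 /negbTE b0] e cG cd]]]|//||].
- apply: (rI_glue (G := G) (q := q)) => //=.
  by rewrite f0 b0 e.
- by move=> *; congruence.
- by move=> *; congruence.
Qed.

Lemma fill_front x y : bc x F = 0 -> (forall v, bc y (a v) = bc x v) ->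
  fill_at (inl i) x = fill_at (inr (bfront B)) y.
Proof.
move=> xF yx; rewrite /= eqxx.
have -> : permute a^-1%g x = y.
  by apply: pnt_eq => v; rewrite bc_permute -{2}(permKV a v) yx.
by rewrite bmap_front // -(ins_faceK a) yx.
Qed.

(** The back triangle fills face F of tetrahedron i without displacement, and
    this face represents the same points as the face of j that was glued to it. *)
Lemma fill_back x y : bc x (p F) = 0 ->
  (forall v, bc y (ins_back T B i a v) = bc x v) ->
  rclass T (fill_at (inl j) x) = rclass T (fill_at (inr (bback B)) y).
Proof.
move=> xF yx; rewrite (fill_face (G := p F)) //; last exact/eqP.
have y1 : bc y (btau B o1) = 0.
  by rewrite -(ins_faceK a) -(ins_backE T B i a) yx.
rewrite /= bmap_back //; symmetry; apply: (rT_glue glue_ij).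
  by rewrite !bc_permute ins_faceK.
by move=> v; rewrite !bc_permute -(ins_backE T B i a) yx.
Qed.

Lemma fill_glued c d : glued T' c d -> rclass T (fill c) = rclass T (fill d).
Proof.
have [s [x ->]] := mkI_surj c; have [s' [y ->]] := mkI_surj d.
rewrite !fill_mkI => /glued_mkI [G [q [+ xG yx]]].
case: s => [l|k]; rewrite /ins_glue.
  case: eqVneq => [[El EG] [Es Eq]|li]; first by subst; rewrite (fill_front xG yx).
  case: eqVneq => [[El EG] [Es Eq]|lj]; first by subst; exact: fill_back.
  have [ri rj] := ins_regular li lj.
  case=> Es Eq; subst s' q.
  rewrite (fill_face li xG) (fill_face ri); last by rewrite yx.
  by apply: (@rT_glue _ _ _ _ G (glue T l G).2) => //; case: (glue T l G).
case: eqVneq => [[El EG] [Es Eq]|kf].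
  subst; rewrite (fill_front (x := y) (y := x)) //; first by rewrite yx.
  by move=> v; rewrite -yx permK.
case: eqVneq => [[El EG] [Es Eq]|kb].
  subst; symmetry; apply: fill_back.
    by rewrite -xG -yx -(ins_faceK a) -(ins_backE T B i a) permK.
  by move=> v; rewrite -yx permK.
case=> Es Eq; subst; rewrite /fill_at; congr (rclass T (mkT i (permute a _))).
apply: (bmap_inner M (c := (k, x)) (d := (_, y))).
by exists G, (bglue k G).2; split=> //=; case: (bglue k G).
Qed.

Definition block_point (z : pnt) : 'I_m * pnt :=
  if pselect (bc z o1 <= 3 * depth z) is left h then projT1 (cid (bmap_surj M h))
  else (bfront B, z).

Lemma block_pointP z : bc z o1 <= 3 * depth z ->
  bmap M (block_point z).1 (block_point z).2 = z.
Proof.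
rewrite /block_point; case: pselect => // h _.
by case: (cid (bmap_surj M h)).
Qed.

(** The inverse of [fill] up to gluing. It need not be continuous, so that block
    points can be chosen arbitrarily. *)
Definition unfill (c : tetrahedra R n) : tetrahedra R (n + m) :=
  let l := projT1 c in let x : pnt := projT2 c in
  let z := permute a^-1%g x in
  if l == i then
    if 3 * depth z <= bc z o1 then mkI (inl i) (permute a (unshrink z))
    else mkI (inr (block_point z).1) (block_point z).2
  else mkI (inl l) x.

Lemma bmap_front_collar z : bc z o1 = 3 * depth z ->
  bmap M (bfront B) (unshrink z) = z.
Proof.
move=> z1; have h : 3 * depth z <= bc z o1 by rewrite z1.
have [_ e1 _ _] := unshrinkE h.
by rewrite bmap_front ?unshrinkK // e1 z1 subrr.
Qed.

Lemma rI_front w : bc w o1 = 0 -> rI (inl i) (permute a w) = rI (inr (bfront B)) w.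
Proof.
move=> w1; apply: (@rI_glue _ _ _ _ F a).
- by rewrite /= eqxx.
- by rewrite bc_permute ins_faceK.
- by move=> v; rewrite bc_permute.
Qed.

Lemma fill_unfill c : rclass T (fill (unfill c)) = rclass T c.
Proof.
case: c => l x; rewrite /unfill /=; case: eqVneq => [->|li]; last first.
  by rewrite fill_mkI /= (negbTE li).
case: leP => h; rewrite fill_mkI /=.
  by rewrite eqxx permuteK unshrinkK // permuteKV.
by rewrite block_pointP ?permuteKV // ltW.
Qed.

(** The case of interest is a block point that is mapped to the inner side of
    the collar: there [unfill] returns a point of the shrunken tetrahedron
    instead, which is glued to the front triangle. *)
Lemma unfill_fill c : rclass T' (unfill (fill c)) = rclass T' c.
Proof.
have [s [x ->]] := mkI_surj c; rewrite fill_mkI.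
case: s => [l|k]; rewrite /fill_at /unfill.
  case: (eqVneq l i) => [->|li] /=; last by rewrite (negbTE li).
  by rewrite eqxx permuteK shrink_out shrinkK permuteKV.
rewrite /= eqxx permuteK; set z := bmap M k x.
have zc : bc z o1 <= 3 * depth z by exact: bmap_collar.
have toz c' : bmap M c'.1 c'.2 = z -> rI (inr c'.1) c'.2 = rI (inr k) x.
  by move=> cz; apply: (rI_bequiv (d := (k, x))); apply: (@bmap_inj _ _ M).
case: leP => h; last by apply: toz; exact: block_pointP.
have z1 : bc z o1 = 3 * depth z by apply/eqP; rewrite eq_le zc h.
have [_ e1 _ _] := unshrinkE h.
change (rI (inl i) (permute a (unshrink z)) = rI (inr k) x).
rewrite rI_front; last by rewrite e1 z1 subrr.
by apply: (toz (bfront B, unshrink z)); exact: bmap_front_collar.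
Qed.

Lemma unfill_face l x G : (l, G) != (i, F) -> bc x G = 0 ->
  rclass T' (unfill (mkT l x)) = rI (inl l) x.
Proof.
move=> lG xG; have := unfill_fill (mkI (inl l) x).
by rewrite fill_mkI (fill_face lG).
Qed.

(** The opened pair of faces is no longer glued in T'. Face F of tetrahedron i
    has become the back triangle of the block, which is glued to the other face
    of the pair. *)
Lemma unfill_front x y : bc x F = 0 -> (forall v, bc y (p v) = bc x v) ->
  rclass T' (unfill (mkT i x)) = rI (inl j) y.
Proof.
move=> xF yx; pose w := permute (ins_back T B i a)^-1%g y.
have wE v : bc w (ins_back T B i a v) = bc y v by rewrite bc_permute permK.
transitivity (rI (inr (bback B)) w); last first.
  symmetry; apply: (@rI_glue _ _ _ _ (p F) (ins_back T B i a)) => //.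
    by rewrite /ins_glue; case: eqP => // _; rewrite eqxx.
  by rewrite yx.
have wb : bc w (btau B o1) = 0.
  by rewrite -(ins_faceK a) -(ins_backE T B i a) wE yx.
have xw : permute a^-1%g x = permute (btau B) w.
  apply: pnt_eq => v; rewrite !bc_permute -{2}(permKV a v).
  by rewrite -(ins_backE T B i a) permK yx.
have := unfill_fill (mkI (inr (bback B)) w).
by rewrite fill_mkI /= bmap_back // -xw permuteKV.
Qed.

Lemma unfill_glued c d : glued T c d ->
  rclass T' (unfill c) = rclass T' (unfill d).
Proof.
case: c d => [l x] [l' y] /glued_mkT [G [q [e xG yx]]].
have yG : bc y (q G) = 0 by rewrite yx.
have [E|li] := eqVneq (l, G) (i, F).
  case: E => El EG; subst l G.
  have [Ej Ep] : l' = j /\ q = p by rewrite e.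
  subst l' q; rewrite (unfill_front xG yx).
  by symmetry; apply: (unfill_face _ yG); exact/eqP.
have [E|lj] := eqVneq (l', q G) (i, F).
  have e' := glue_sym e; case: E => El Eq; rewrite El Eq in e' yG.
  subst l'; have [Ej Ep] : l = j /\ q^-1%g = p by rewrite e'.
  subst l; rewrite (unfill_face li xG); symmetry; apply: unfill_front => // v.
  by rewrite -Ep -yx permKV.
rewrite (unfill_face li xG) (unfill_face lj yG).
have lj' : (l, G) != (j, p F).
  apply: contra lj => /eqP [El EG]; have := glue_sym glue_ij.
  by rewrite -El -EG e => -[-> ->]; rewrite EG permK.
apply: (@rI_glue _ _ _ _ G q) => //=.
by rewrite (negbTE li) (negbTE lj') e.
Qed.

Lemma insert_bijection : exists h : realization R T' -> realization R T,
  [/\ continuous h, injective h & forall y, exists x, h x = y].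
Proof.
apply: (@realization_bijection _ _ _ _ _ fill unfill).
- apply: (cont_comp fill_continuous); exact: rclass_continuous.
- exact: fill_glued.
- exact: unfill_glued.
- exact: fill_unfill.
- exact: unfill_fill.
Qed.

End InsertTopology.

(** * The double of a tetrahedron *)

Lemma double_sym (i : 'I_2) (F : 'I_4) j (p : 'S_4) :
  (rev_ord i, 1%g) = (j, p) -> (rev_ord j, 1%g) = (i, p^-1%g).
Proof. by case=> <- <-; rewrite rev_ordK invg1. Qed.

Lemma double_neq (i : 'I_2) (F : 'I_4) j (p : 'S_4) :
  (rev_ord i, 1%g) = (j, p) -> (j, p F) <> (i, F).
Proof. by case=> <- _ [] /(congr1 val) /=; case: i => [[|[|]]]. Qed.

Definition double_simplex : gluing 2 :=
  @Gluing 2 (fun i _ => (rev_ord i, 1%g)) double_sym double_neq.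

Section DoubleSimplex.
Variable R : realType.
Local Notation pnt := (pnt R).
Local Notation Y := (realization R double_simplex).
Local Notation tet := (tetrahedra R 2).

Definition min4 (x : pnt) : R := Num.min (bc x o1) (depth x).
Definition side (i : 'I_2) : R := if i == ord0 then 1 else -1.

Lemma min4_ge0 x : 0 <= min4 x.
Proof. by rewrite le_min bc_ge0 depth_ge0. Qed.

Lemma min4_eq0 x : min4 x = 0 -> exists v, bc x v = 0.
Proof.
rewrite /min4; case: leP => _ x0; first by exists o1.
by have [_ _ _ []] := depthP x; rewrite x0 => /esym; [exists o0|exists o2|exists o3].
Qed.

Lemma min4_face x v : bc x v = 0 -> min4 x = 0.
Proof.
move=> xv; apply/eqP; rewrite eq_le min4_ge0 andbT -xv.
have [x0 x2 x3 _] := depthP x; move: v {xv}.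
by apply: ord4_ind; rewrite /min4 ge_min ?lexx ?x0 ?x2 ?x3 ?orbT.
Qed.

Lemma min4_continuous : continuous min4.
Proof. by apply: cont_min; [exact: bc_continuous|exact: depth_continuous]. Qed.

Lemma side_norm i : `|side i| = 1.
Proof. by rewrite /side; case: ifP; rewrite ?normrN normr1. Qed.

Let glued_eq (c d : tet) : glued double_simplex c d ->
  projT2 c = projT2 d :> pnt /\ min4 (projT2 c) = 0.
Proof.
case: c d => [i x] [j y] [F [p [[_ <-] xF yx]]] /=; split; last exact: min4_face xF.
by apply: pnt_eq => v; have := yx v; rewrite perm1.
Qed.

(** The double embeds into the product of the tetrahedron and a line, by lifting
    the point x of one copy to the height min x and that of the other copy to
    the opposite height. The heights agree exactly on the boundary, where the
    copies are glued. *)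
Lemma double_coords : exists (X : Y -> pnt) (W : Y -> R),
  [/\ continuous X, continuous W,
      forall y y', X y = X y' -> W y = W y' -> y = y',
      forall y, `|W y| = min4 (X y) &
      forall x w, `|w| = min4 x -> exists y, X y = x /\ W y = w].
Proof.
have c1 : continuous (fun c : tet => projT2 c : pnt).
  by apply: (@sigT_continuous _ _ _ (fun _ x => x)) => i x.
have [X Xc XE] := realization_lift c1 (fun c d cd => (glued_eq cd).1).
have c2 : continuous (fun c : tet => side (projT1 c) * min4 (projT2 c)).
  apply: (@sigT_continuous _ (fun _ : 'I_2 => pnt) _ (fun i x => side i * min4 x)).
  by move=> i; apply: contM; [exact: cont_cst|exact: min4_continuous].
have [|W Wc WE] := realization_lift (T := double_simplex) c2.
  by move=> c d /glued_eq [<- ->]; rewrite !mulr0.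
exists X, W; split=> //.
- move=> y y'; have [[i x] <-] := rclass_surj y; have [[i' x'] <-] := rclass_surj y'.
  rewrite !XE !WE /= => <-; case: (eqVneq i i') => [->//|ii'] sx.
  have ii : i' = rev_ord i.
    apply: val_inj => /=; move: ii' {sx}; rewrite -(inj_eq val_inj) /=.
    by case: i i' => [k hk] [k' hk'] /=; lia.
  have m0 : min4 x = 0.
    have := min4_ge0 x; move: sx ii'; rewrite ii /side.
    by rewrite -!(inj_eq val_inj) /=; case: i {ii} => [[|[|//]] hk] /=; lra.
  have [F xF] := min4_eq0 m0; apply: glued_rclass.
  exists F, 1%g; split=> //=; first by rewrite ii.
  by move=> v; rewrite perm1.
- move=> y; have [[i x] <-] := rclass_surj y; rewrite XE WE /= normrM side_norm mul1r.
  by rewrite ger0_norm ?min4_ge0.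
- move=> x w wx; case: (leP 0 w) => w0.
    exists (rclass double_simplex (existT _ ord0 x)); rewrite XE WE /= -wx /side eqxx mul1r.
    by rewrite ger0_norm.
  exists (rclass double_simplex (existT _ ord_max x)); rewrite XE WE /= -wx /side /=.
  by rewrite ltr0_norm // mulN1r opprK.
Qed.

Definition q0 : 'I_3 := @Ordinal 3 0 isT.
Definition q1 : 'I_3 := @Ordinal 3 1 isT.
Definition q2 : 'I_3 := @Ordinal 3 2 isT.

Lemma ord3_ind (P : 'I_3 -> Prop) : P q0 -> P q1 -> P q2 -> forall v, P v.
Proof.
move=> P0 P1 P2 [[|[|[|v]]] lt3] //.
- by rewrite (_ : Ordinal lt3 = q0) //; apply: val_inj.
- by rewrite (_ : Ordinal lt3 = q1) //; apply: val_inj.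
- by rewrite (_ : Ordinal lt3 = q2) //; apply: val_inj.
Qed.

Definition min_of3 (z : 'I_3 -> R) : R := Num.min (z q0) (Num.min (z q1) (z q2)).

Lemma min4_lift v (x : pnt) : min4 x = Num.min (bc x v) (min_of3 (fun k => bc x (lift v k))).
Proof.
have E : min4 x = Num.min (bc x o0) (Num.min (bc x o1) (Num.min (bc x o2) (bc x o3))).
  by rewrite /min4 /depth minCA.
rewrite {}E /min_of3.
have l0 : [/\ lift o0 q0 = o1, lift o0 q1 = o2 & lift o0 q2 = o3] by split; apply: val_inj.
have l1 : [/\ lift o1 q0 = o0, lift o1 q1 = o2 & lift o1 q2 = o3] by split; apply: val_inj.
have l2 : [/\ lift o2 q0 = o0, lift o2 q1 = o1 & lift o2 q2 = o3] by split; apply: val_inj.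
have l3 : [/\ lift o3 q0 = o0, lift o3 q1 = o1 & lift o3 q2 = o2] by split; apply: val_inj.
move: v; apply: ord4_ind.
- by case: l0 => -> -> ->.
- by case: l1 => -> -> ->; rewrite minCA.
- by case: l2 => -> -> ->; rewrite !(minCA (bc x o2)).
- by case: l3 => -> -> ->; rewrite !(minCA (bc x o3)) (minC (bc x o3)).
Qed.

Lemma bc_sum_lift v (x : pnt) :
  bc x v + (bc x (lift v q0) + bc x (lift v q1) + bc x (lift v q2)) = 1.
Proof.
rewrite -(bc_sum x); move: v; apply: ord4_ind.
- by rewrite (_ : lift o0 q0 = o1) 1?(_ : lift o0 q1 = o2) 1?(_ : lift o0 q2 = o3);
     [ring|exact: val_inj..].
- by rewrite (_ : lift o1 q0 = o0) 1?(_ : lift o1 q1 = o2) 1?(_ : lift o1 q2 = o3);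
     [ring|exact: val_inj..].
- by rewrite (_ : lift o2 q0 = o0) 1?(_ : lift o2 q1 = o1) 1?(_ : lift o2 q2 = o3);
     [ring|exact: val_inj..].
- by rewrite (_ : lift o3 q0 = o0) 1?(_ : lift o3 q1 = o1) 1?(_ : lift o3 q2 = o2);
     [ring|exact: val_inj..].
Qed.

Lemma pnt_lift v (xv : R) (xk : 'I_3 -> R) :
  0 <= xv -> (forall k, 0 <= xk k) -> xv + (xk q0 + xk q1 + xk q2) = 1 ->
  exists x : pnt, bc x v = xv /\ forall k, bc x (lift v k) = xk k.
Proof.
move=> xv0 xk0 xs; pose r : 'rV[R]_4 := \row_u oapp xk xv (unlift v u).
have rv : r ord0 v = xv by rewrite mxE unlift_none.
have rk k : r ord0 (lift v k) = xk k by rewrite mxE liftK.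
have sr : r \in @simplex3 R.
  apply/mem_set; split; first by move=> u; rewrite mxE; case: (unlift v u) => [k|] /=.
  rewrite (bigD1_ord v) //= rv -xs; congr (_ + _).
  rewrite !big_ord_recl big_ord0 addr0 !rk addrA.
  by congr (xk _ + xk _ + xk _); apply: val_inj.
by exists (SigSub sr); rewrite /bc set_valE; split.
Qed.

Lemma pnt_eq_lift v (x y : pnt) : bc x v = bc y v ->
  (forall k, bc x (lift v k) = bc y (lift v k)) -> x = y.
Proof.
move=> xyv xyk; apply: pnt_eq => u.
by case: (unliftP v u) => [k|] ->.
Qed.

Lemma min_of3P (z : 'I_3 -> R) : [/\ min_of3 z <= z q0, min_of3 z <= z q1, min_of3 z <= z q2 &
  [\/ min_of3 z = z q0, min_of3 z = z q1 | min_of3 z = z q2]].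
Proof. exact: min3P. Qed.

Lemma min_of3_le z k : min_of3 z <= z k.
Proof. by have [? ? ? _] := min_of3P z; move: k; apply: ord3_ind. Qed.

Lemma min_of3_eq (z : 'I_3 -> R) m : (forall k, m <= z k) ->
  [\/ m = z q0, m = z q1 | m = z q2] -> min_of3 z = m.
Proof. by move=> zm; apply: min3_eq. Qed.

Lemma min_of3_shift (z : 'I_3 -> R) c : min_of3 (fun k => z k + c) = min_of3 z + c.
Proof.
apply: min_of3_eq => [k|]; first by rewrite lerD2r min_of3_le.
by have [_ _ _ [] ->] := min_of3P z; [apply: Or31|apply: Or32|apply: Or33].
Qed.

(** On the part of the double where the coordinate xv is positive, w = +-min(xv,
    m) determines +-m continuously: the quotient m / min(xv, m) is 1 + max(0, m
    - xv) / xv. *)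
Definition unclamp (m xv w : R) := w * (1 + Num.max 0 (m - xv) / xv).
Definition clamp (xv c : R) := Num.max (- xv) (Num.min xv c).

Lemma unclampP m xv w : 0 < xv -> `|w| = Num.min xv m ->
  `|unclamp m xv w| = m /\ clamp xv (unclamp m xv w) = w.
Proof.
move=> xv0 wm; rewrite /unclamp /clamp.
have xvN : xv != 0 by rewrite gt_eqF.
case: (leP xv m) wm => xm wm.
  rewrite (max_idPr _) ?subr_ge0 //.
  have -> : 1 + (m - xv) / xv = m / xv by rewrite mulrBl divff // addrC subrK.
  have m0 : 0 < m by lra.
  case: (leP 0 w) wm => w0; [rewrite ger0_norm // => ->|rewrite ltr0_norm // => wx].
    rewrite mulrCA divff // mulr1 gtr0_norm //; split=> //.
    by rewrite (min_idPl _) // (max_idPr _) //; lra.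
  have -> : w = - xv by lra.
  rewrite mulNr mulrCA divff // mulr1 normrN gtr0_norm //; split=> //.
  by rewrite (min_idPr _) ?(max_idPl _) //; lra.
rewrite (max_idPl _) ?mul0r ?addr0 ?mulr1; last by lra.
split=> //; have : `|w| <= xv by lra.
by rewrite ler_norml => /andP[w1 w2]; rewrite (min_idPr _) ?(max_idPr _).
Qed.

Lemma norm_clamp xv c : 0 <= xv -> `|clamp xv c| = Num.min xv `|c|.
Proof.
move=> xv0; rewrite /clamp; case: (leP xv c) => xc.
  rewrite (max_idPr _); last by lra.
  rewrite ger0_norm // (min_idPl _) //; exact: le_trans (ler_norm c).
case: (leP (- xv) c) => xc'.
  by rewrite (min_idPr _) // ler_norml; lra.
have c0 : c < 0 by lra.
by rewrite normrN ger0_norm // ltr0_norm // (min_idPl _) //; lra.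
Qed.

Lemma clamp_inj xv c d : 0 < xv -> `|c| = `|d| -> clamp xv c = clamp xv d -> c = d.
Proof.
move=> xv0 /eqP; rewrite eqr_norm2 => /orP[/eqP//|/eqP ->].
rewrite /clamp /Order.max /Order.min.
by case: (ltP xv (- d)) => ?; case: (ltP xv d) => ?; repeat case: ltP => ?; lra.
Qed.

Lemma cont_inv (Z : topologicalType) (f : Z -> R) :
  continuous f -> (forall x, f x != 0) -> continuous (fun x => (f x)^-1).
Proof. by move=> fc f0 x; apply: cvgV => //; exact: fc. Qed.

Section Charts.
Variables (X : Y -> pnt) (W : Y -> R).
Hypothesis Xc : continuous X.
Hypothesis Wc : continuous W.
Hypothesis XWI : forall y y', X y = X y' -> W y = W y' -> y = y'.
Hypothesis XWn : forall y, `|W y| = min4 (X y).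
Hypothesis XWS : forall x w, `|w| = min4 x -> exists y, X y = x /\ W y = w.

Definition emb (y : Y) : 'rV[R]_5 :=
  \row_k oapp (fun v => bc (X y) v) (W y) (unlift ord_max k).

Lemma embE1 y v : emb y ord0 (lift ord_max v) = bc (X y) v.
Proof. by rewrite mxE liftK. Qed.

Lemma embE2 y : emb y ord0 ord_max = W y.
Proof. by rewrite mxE unlift_none. Qed.

Lemma emb_comp_continuous (Z : topologicalType) (g : Z -> Y) :
  (forall v, continuous (fun z => bc (X (g z)) v)) ->
  continuous (fun z => W (g z)) -> continuous (emb \o g).
Proof.
move=> c1 c2; apply: continuous_row => k.
case: (unliftP ord_max k) => [v|] ->; rewrite /comp.
  by under eq_fun do rewrite embE1; exact: c1.
by under eq_fun do rewrite embE2; exact: c2.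
Qed.

Lemma Xcoord_continuous v : continuous (fun y => bc (X y) v).
Proof. exact: (cont_comp Xc (@bc_continuous R v)). Qed.

Lemma emb_continuous : continuous emb.
Proof.
apply: (@emb_comp_continuous _ id) => [v|]; last exact: Wc.
exact: Xcoord_continuous.
Qed.

Lemma emb_inj : injective emb.
Proof.
move=> y y' e; apply: XWI; last by rewrite -!embE2 e.
by apply: pnt_eq => v; rewrite -!embE1 e.
Qed.

Lemma double_hausdorff : hausdorff_space Y.
Proof.
exact: (injective_hausdorff (@norm_hausdorff _ _) emb_continuous emb_inj).
Qed.

Lemma double_second_countable : @second_countable Y.
Proof.
apply: (compact_injection_second_countable (R := R) (h := emb)).
- exact: realization_compact.
- exact: norm_hausdorff.
- exact: emb_continuous.
- exact: emb_inj.
Qed.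

Section Chart.
Variable v : 'I_4.

Definition zmin (z : 'rV[R]_3) : R := min_of3 (fun k => z ord0 k).
(** Coordinates in R^3 of the chart at vertex v are obtained from the three
    barycentric coordinates other than that of v by sliding along the diagonal
    until their minimum m becomes +-m, with a sign telling the copies apart. The
    inverse replaces the minimum of z by its absolute value. *)
Definition zbc (z : 'rV[R]_3) k : R := z ord0 k - zmin z + `|zmin z|.
Definition zsum (z : 'rV[R]_3) : R := zbc z q0 + zbc z q1 + zbc z q2.

Lemma zmin_continuous : continuous zmin.
Proof.
by apply: cont_min; [|apply: cont_min]; exact: coord_row_continuous.
Qed.

Lemma zbc_continuous k : continuous (zbc ^~ k).
Proof.
apply: contD; last exact: (cont_norm zmin_continuous).
by apply: contB; [exact: coord_row_continuous|exact: zmin_continuous].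
Qed.

Lemma zsum_continuous : continuous zsum.
Proof.
by apply: contD; [apply: contD|]; exact: zbc_continuous.
Qed.

Definition chart_dom : set Y := [set y | 0 < bc (X y) v].
Definition chart_im : set 'rV[R]_3 := [set z | zsum z < 1].

Lemma open_chart_dom : open chart_dom.
Proof.
apply: (@open_comp _ _ (fun y => bc (X y) v) [set r : R | 0 < r]).
  by move=> y _; exact: Xcoord_continuous.
exact: open_gt.
Qed.

Lemma open_chart_im : open chart_im.
Proof.
apply: (@open_comp _ _ zsum [set r : R | r < 1]).
  by move=> y _; exact: zsum_continuous.
exact: open_lt.
Qed.

Definition ymin (y : Y) : R := min_of3 (fun k => bc (X y) (lift v k)).
Definition yval (y : Y) : R := unclamp (ymin y) (bc (X y) v) (W y).
Definition chart (y : Y) : 'rV[R]_3 :=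
  \row_k (bc (X y) (lift v k) - ymin y + yval y).

Lemma ymin_continuous : continuous ymin.
Proof.
by apply: cont_min; [|apply: cont_min]; exact: Xcoord_continuous.
Qed.

Lemma yvalP y : chart_dom y ->
  `|yval y| = ymin y /\ clamp (bc (X y) v) (yval y) = W y.
Proof. by move=> yU; apply: unclampP => //; rewrite XWn (min4_lift v). Qed.

Lemma zmin_chart y : zmin (chart y) = yval y.
Proof.
rewrite /zmin (_ : (fun k => _) = (fun k => bc (X y) (lift v k) + (yval y - ymin y))).
  by rewrite min_of3_shift /ymin; ring.
by apply: boolp.funext => k; rewrite mxE; ring.
Qed.

Lemma zbc_chart y k : chart_dom y -> zbc (chart y) k = bc (X y) (lift v k).
Proof.
by move=> /yvalP [nE _]; rewrite /zbc zmin_chart nE mxE; ring.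
Qed.

Lemma chart_in y : chart_dom y -> chart_im (chart y).
Proof.
move=> yU; rewrite /chart_im /= /zsum !zbc_chart //.
by have := bc_sum_lift v (X y); have : 0 < bc (X y) v := yU; lra.
Qed.

Lemma zbc_ge0 z k : 0 <= zbc z k.
Proof. by rewrite /zbc addr_ge0 // subr_ge0 min_of3_le. Qed.

Lemma chart_inv z : chart_im z -> exists y,
  [/\ bc (X y) v = 1 - zsum z, forall k, bc (X y) (lift v k) = zbc z k &
      W y = clamp (1 - zsum z) (zmin z)].
Proof.
move=> zV; have s0 : 0 <= 1 - zsum z by have : zsum z < 1 := zV; lra.
have [|x [xv xk]] := pnt_lift v s0 (zbc_ge0 z).
  by rewrite -/(zsum z); ring.
have [|y [yx yw]] := XWS (x := x) (w := clamp (1 - zsum z) (zmin z)).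
  rewrite norm_clamp // (min4_lift v) xv; congr (Num.min _ _).
  rewrite (_ : (fun k => _) = (fun k => z ord0 k + (`|zmin z| - zmin z))).
    by rewrite min_of3_shift /zmin; ring.
  by apply: boolp.funext => k; rewrite xk /zbc; ring.
by exists y; split=> // [|k]; rewrite yx.
Qed.

(** The sign is continuous only when it is multiplied by the minimum; [unclamp]
    writes the product in terms of continuous functions. *)
Lemma chart_continuous :
  continuous (fun y : set_type chart_dom => chart (set_val y)).
Proof.
pose sv := (set_val : set_type chart_dom -> Y).
have sc : continuous sv by exact: set_val_continuous.
have mc := cont_comp sc ymin_continuous.
have vc := cont_comp sc (@Xcoord_continuous v).
have wc := cont_comp sc Wc.
apply: continuous_row => k.
under eq_fun do rewrite mxE.
apply: contD; first apply: contB => //.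
  exact: (cont_comp sc (@Xcoord_continuous (lift v k))).
apply: contM => //; apply: contD; first exact: cont_cst.
apply: contM.
  by apply: cont_max; [exact: cont_cst|exact: contB].
apply: cont_inv => // y; rewrite gt_eqF //; exact: (set_valP y).
Qed.

(** The inverse is obtained pointwise from [chart_inv]. Its continuity can be
    tested in the embedding into R^5, where its components are explicit. *)
Lemma chart_homeomorphic : homeomorphic_sets chart_dom chart_im.
Proof.
have fS (y : set_type chart_dom) : chart (set_val y) \in chart_im.
  by apply/mem_set/chart_in/set_valP.
have [g gP] := choice (fun z : set_type chart_im => chart_inv (set_valP z)).
have gS z : g z \in chart_dom.
  apply/mem_set; rewrite /chart_dom /=; have [-> _ _] := gP z.
  by have : zsum (set_val z) < 1 := set_valP z; lra.
exists (fun y => SigSub (fS y)), (fun z => SigSub (gS z)); split.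
- apply: continuous_comp_initial; exact: chart_continuous.
- apply: continuous_comp_initial.
  apply: (continuous_lift_injection (h := emb)).
  + exact: realization_compact.
  + exact: norm_hausdorff.
  + exact: emb_continuous.
  + exact: emb_inj.
  pose sv := (set_val : set_type chart_im -> 'rV[R]_3).
  have sc : continuous sv by exact: set_val_continuous.
  have c1 : continuous (fun z => 1 - zsum (sv z)).
    by apply: contB; [exact: cont_cst|exact: (cont_comp sc zsum_continuous)].
  apply: emb_comp_continuous => [u|] /=.
    case: (unliftP v u) => [k|] ->.
      rewrite (_ : (fun z => _) = (fun z => zbc (sv z) k)).
        exact: (cont_comp sc (@zbc_continuous k)).
      by apply: boolp.funext => z; have [_ -> _] := gP z.
    rewrite (_ : (fun z => _) = (fun z => 1 - zsum (sv z))) //.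
    by apply: boolp.funext => z; have [-> _ _] := gP z.
  rewrite (_ : (fun z => _) = (fun z => clamp (1 - zsum (sv z)) (zmin (sv z)))).
    apply: cont_max; first exact: contN.
    by apply: cont_min => //; exact: (cont_comp sc zmin_continuous).
  by apply: boolp.funext => z; have [_ _ ->] := gP z.
- move=> y; apply: val_inj => /=; have yU : chart_dom (set_val y) := set_valP y.
  have [nE wE] := yvalP yU.
  set z := SigSub (fS y).
  have [e1 e2 e3] : [/\ bc (X (g z)) v = 1 - zsum (chart (set_val y)),
    forall k, bc (X (g z)) (lift v k) = zbc (chart (set_val y)) k &
    W (g z) = clamp (1 - zsum (chart (set_val y))) (zmin (chart (set_val y)))].
    exact: (gP z).
  have E1 : 1 - zsum (chart (set_val y)) = bc (X (set_val y)) v.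
    rewrite /zsum !zbc_chart //; have := bc_sum_lift v (X (set_val y)); lra.
  apply: XWI; last by rewrite e3 E1 zmin_chart wE.
  by apply: (pnt_eq_lift (v := v)) => [|k]; [rewrite e1|rewrite e2 zbc_chart].
- move=> z; apply: val_inj => /=; have [e1 e2 e3] := gP z.
  have yU : chart_dom (g z) by apply/set_mem/gS.
  have [nE wE] := yvalP yU.
  have xv0 : 0 < bc (X (g z)) v := yU.
  have ymE : ymin (g z) = `|zmin (set_val z)|.
    rewrite /ymin (_ : (fun k => _) =
      (fun k => set_val z ord0 k + (`|zmin (set_val z)| - zmin (set_val z)))).
      by rewrite min_of3_shift /zmin; ring.
    by apply: boolp.funext => k; rewrite e2 /zbc; ring.
  have yvE : yval (g z) = zmin (set_val z).
    apply: (@clamp_inj (bc (X (g z)) v)) => //; first by rewrite nE ymE.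
    by rewrite wE e3 e1.
  by apply/rowP => k; rewrite mxE e2 ymE yvE /zbc; ring.
Qed.

End Chart.

Lemma double_closed_manifold_aux : closed_manifold R 3 Y.
Proof.
split.
- exact: double_hausdorff.
- exact: double_second_countable.
- move=> y; have [v yv] : exists v, 0 < bc (X y) v.
    apply: contrapT => /forallNP h.
    have h' v : bc (X y) v <= 0 by rewrite leNgt; apply/negP/h.
    have := bc_sum (X y); have := h' o0; have := h' o1; have := h' o2; have := h' o3.
    lra.
  exists (chart_dom v), chart_im; split=> //.
  + exact: open_chart_dom.
  + exact: open_chart_im.
  + exact: chart_homeomorphic.
- exact: realization_compact.
Qed.

End Charts.

Lemma double_closed_manifold : closed_manifold R 3 Y.
Proof.
have [X [W [Xc Wc XWI XWn XWS]]] := double_coords.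
exact: (double_closed_manifold_aux Xc Wc XWI XWn XWS).
Qed.

End DoubleSimplex.

(** * Parametrizing the collar *)

Section Core.
Variable R : realType.
Local Notation pnt := (pnt R).

(** The collar of face 1 is the union of two copies of the tetrahedron, doubled
    along the faces 0, 2 and 3: a point of the double is a point x with a height
    nu such that |nu| = depth x, the copies being nu >= 0 and nu <= 0. For x on
    face 1 (depth m) the two copies yield the inner side and the face 1 of the
    collar, and vertex 1 of x becomes the centre of the lens. *)
Definition core (nu : R) (x : pnt) : pnt :=
  let u := (`|nu| + bc x o1 / 3 + nu) / 4 in
  mkpt (bc x o0 + bc x o1 / 3 - u) (3 * u)
       (bc x o2 + bc x o1 / 3 - u) (bc x o3 + bc x o1 / 3 - u).

Lemma coreE nu x : `|nu| = depth x ->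
  let u := (depth x + bc x o1 / 3 + nu) / 4 in
  [/\ bc (core nu x) o0 = bc x o0 + bc x o1 / 3 - u,
      bc (core nu x) o1 = 3 * u,
      bc (core nu x) o2 = bc x o2 + bc x o1 / 3 - u &
      bc (core nu x) o3 = bc x o3 + bc x o1 / 3 - u].
Proof.
move=> nx /=; have [x0 x2 x3 _] := depthP x; have x1 := bc_ge0 x o1.
have xs := bc_sum x; have : `|nu| <= depth x by rewrite nx.
rewrite ler_norml /core nx => /andP[n1 n2]; apply: mkptE; lra.
Qed.

Lemma depth_core nu x : `|nu| = depth x ->
  depth (core nu x) = depth x + bc x o1 / 3 - (depth x + bc x o1 / 3 + nu) / 4.
Proof.
move=> nx; have [e0 e1 e2 e3] := coreE nx; have [x0 x2 x3 M] := depthP x.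
apply: depth_eq; rewrite ?e0 ?e2 ?e3; [lra|lra|lra|].
by case: M => M; [apply: Or31|apply: Or32|apply: Or33]; lra.
Qed.

Lemma core_collar nu x : `|nu| = depth x -> bc (core nu x) o1 <= 3 * depth (core nu x).
Proof.
move=> nx; have [_ -> _ _] := coreE nx; rewrite depth_core //.
have : `|nu| <= depth x by rewrite nx.
by rewrite ler_norml => /andP[n1 n2]; have := bc_ge0 x o1; lra.
Qed.

(** The collar point determines nu and depth x from its coordinate 1 and its
    depth, and then x. *)
Lemma core_inj nu x nu' x' : `|nu| = depth x -> `|nu'| = depth x' ->
  core nu x = core nu' x' -> nu = nu' /\ x = x'.
Proof.
move=> nx nx' E; have [e0 e1 e2 e3] := coreE nx; have [f0 f1 f2 f3] := coreE nx'.
have := depth_core nx; have := depth_core nx'; rewrite E in e0 e1 e2 e3 * => m1 m2.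
have nn : nu = nu' by lra.
have mm : depth x = depth x' by rewrite -nx -nx' nn.
by split=> //; apply: pnt_eq; apply: ord4_ind; lra.
Qed.

Lemma core_surj z : bc z o1 <= 3 * depth z ->
  exists nu x, `|nu| = depth x /\ core nu x = z.
Proof.
(* solve coreE for nu and x, where u = bc z 1 / 3 and m = depth x + bc x 1 / 3 *)
move=> zc; pose u := bc z o1 / 3; pose m := depth z + u; pose nu := 4 * u - m.
have z1 := bc_ge0 z o1; have [z0 z2 z3 M] := depthP z; have zs := bc_sum z.
have nm : `|nu| <= m by rewrite ler_norml /nu /m /u; lra.
have n0 := normr_ge0 nu.
pose x := mkpt (bc z o0 - depth z + `|nu|) (3 * (m - `|nu|))
  (bc z o2 - depth z + `|nu|) (bc z o3 - depth z + `|nu|).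
have [e0 e1 e2 e3] : [/\ bc x o0 = bc z o0 - depth z + `|nu|,
  bc x o1 = 3 * (m - `|nu|), bc x o2 = bc z o2 - depth z + `|nu| &
  bc x o3 = bc z o3 - depth z + `|nu|].
  have mE : m = depth z + bc z o1 / 3 by [].
  by apply: mkptE; lra.
exists nu, x.
have nx : `|nu| = depth x.
  symmetry; apply: depth_eq; rewrite ?e0 ?e2 ?e3; [lra|lra|lra|].
  by case: M => M; [apply: Or31|apply: Or32|apply: Or33]; lra.
split=> //; have [f0 f1 f2 f3] := coreE nx.
have nuE : nu = 4 * u - depth z - u by rewrite /nu /m; ring.
rewrite -nx in f0 f1 f2 f3; move: f0 f1 f2 f3 nuE.
rewrite e0 e1 e2 e3 /m /u => f0 f1 f2 f3 nuE.
by apply: pnt_eq; apply: ord4_ind; lra.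
Qed.

Lemma core_front x : bc x o1 = 0 -> core (depth x) x = shrink x.
Proof.
move=> x1; have nx : `|depth x| = depth x by rewrite ger0_norm ?depth_ge0.
have [e0 e1 e2 e3] := coreE nx; have [f0 f1 f2 f3] := shrinkE x.
by apply: pnt_eq; apply: ord4_ind; lra.
Qed.

Lemma core_back x : bc x o1 = 0 -> core (- depth x) x = x.
Proof.
move=> x1; have nx : `|- depth x| = depth x by rewrite normrN ger0_norm ?depth_ge0.
have [e0 e1 e2 e3] := coreE nx.
by apply: pnt_eq; apply: ord4_ind; lra.
Qed.

Lemma core_continuous (Z : topologicalType) (nu : Z -> R) (x : Z -> pnt) :
  (forall t, `|nu t| = depth (x t)) -> continuous nu -> continuous x ->
  continuous (fun t => core (nu t) (x t)).
Proof.
move=> nx nc xc.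
have bcc v : continuous (fun t => bc (x t) v) := cont_comp xc (@bc_continuous R v).
have mc : continuous (fun t => depth (x t)) := cont_comp xc (@depth_continuous R).
have uc : continuous (fun t => (depth (x t) + bc (x t) o1 / 3 + nu t) / 4).
  apply: contM; last exact: cont_cst.
  apply: contD => //; apply: contD => //; apply: contM => //; exact: cont_cst.
have c3 v : continuous (fun t => bc (x t) v + bc (x t) o1 / 3 -
    (depth (x t) + bc (x t) o1 / 3 + nu t) / 4).
  apply: contB => //; apply: contD => //; apply: contM => //; exact: cont_cst.
apply: continuous_pnt; apply: ord4_ind.
- rewrite (_ : (fun t => _) = (fun t => bc (x t) o0 + bc (x t) o1 / 3 -
    (depth (x t) + bc (x t) o1 / 3 + nu t) / 4)) //.
  by apply: boolp.funext => t; have [-> _ _ _] := coreE (nx t).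
- rewrite (_ : (fun t => _) = (fun t => 3 * ((depth (x t) + bc (x t) o1 / 3 + nu t) / 4))).
    by apply: contM => //; exact: cont_cst.
  by apply: boolp.funext => t; have [_ -> _ _] := coreE (nx t).
- rewrite (_ : (fun t => _) = (fun t => bc (x t) o2 + bc (x t) o1 / 3 -
    (depth (x t) + bc (x t) o1 / 3 + nu t) / 4)) //.
  by apply: boolp.funext => t; have [_ _ -> _] := coreE (nx t).
- rewrite (_ : (fun t => _) = (fun t => bc (x t) o3 + bc (x t) o1 / 3 -
    (depth (x t) + bc (x t) o1 / 3 + nu t) / 4)) //.
  by apply: boolp.funext => t; have [_ _ _ ->] := coreE (nx t).
Qed.

Variables (B : block) (nu : 'I_(bsize B) -> pnt -> R).
Variable foot : 'I_(bsize B) -> pnt -> pnt.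
Hypothesis nuE : forall k w, `|nu k w| = depth (foot k w).
Hypothesis nu_continuous : forall k, continuous (nu k).
Hypothesis foot_continuous : forall k, continuous (foot k).
Hypothesis foot_front : forall w, bc w o1 = 0 ->
  foot (bfront B) w = w /\ nu (bfront B) w = depth w.
Hypothesis foot_back : forall w, bc w (btau B o1) = 0 ->
  foot (bback B) w = permute (btau B) w /\
  nu (bback B) w = - depth (permute (btau B) w).
Hypothesis foot_inner : forall c d : 'I_(bsize B) * pnt, bstep c d ->
  foot c.1 c.2 = foot d.1 d.2 /\ nu c.1 c.2 = nu d.1 d.2.
Hypothesis foot_surj : forall x t, `|t| = depth x ->
  exists c, foot c.1 c.2 = x /\ nu c.1 c.2 = t.
Hypothesis foot_inj : forall c d : 'I_(bsize B) * pnt,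
  foot c.1 c.2 = foot d.1 d.2 -> nu c.1 c.2 = nu d.1 d.2 -> bequiv c d.

(** It is enough to map the block to the doubled tetrahedron of [core]. *)
Lemma block_map_core : block_map R B.
Proof.
apply: (@BlockMap _ _ (fun k w => core (nu k w) (foot k w))).
- by move=> k; apply: core_continuous.
- by move=> k w; apply: core_collar.
- by move=> w w1; have [-> ->] := foot_front w1; exact: core_front.
- move=> w w1; have [-> ->] := foot_back w1; apply: core_back.
  by rewrite bc_permute.
- by move=> c d /foot_inner [-> ->].
- move=> z /core_surj [t [x [tx <-]]]; have [c [cx ct]] := foot_surj tx.
  by exists c; rewrite cx ct.
- move=> c d /core_inj-/(_ (nuE _ _) (nuE _ _)) [e1 e2]; exact: foot_inj.
Qed.

End Core.

(** * The cone block *)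

Lemma cone_free : (ord0 : 'I_2, o1) <> (ord_max : 'I_2, (1%g : 'S_4) o1).
Proof. by []. Qed.

Definition cone_glue (k : 'I_2) (G : 'I_4) : 'I_2 * 'S_4 := (rev_ord k, 1%g).

Lemma cone_inner (k : 'I_2) G : G != o1 <->
  (k, G) != (ord0, o1) /\ (k, G) != (ord_max, (1%g : 'S_4) o1).
Proof.
rewrite perm1 !xpair_eqE !negb_and; split.
  by move=> ->; rewrite !orbT.
by case: k => [[|[|//]] hk] /= [].
Qed.

Lemma cone_inner_stable (k : 'I_2) G k' (q : 'S_4) :
  (k, G) != (ord0, o1) /\ (k, G) != (ord_max, (1%g : 'S_4) o1) ->
  cone_glue k G = (k', q) ->
  (k', q G) != (ord0, o1) /\ (k', q G) != (ord_max, (1%g : 'S_4) o1).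
Proof. by move=> /cone_inner Go [_ <-]; apply/cone_inner; rewrite perm1. Qed.

(** Two tetrahedra glued along the faces 0, 2 and 3 by the identity: the cone,
    with apex at vertex 1, over the sphere formed by the free triangles. *)
Definition cone_block : block.
Proof.
refine (@Block 2 cone_glue ord0 ord_max 1%g cone_free cone_inner_stable _ _).
- by move=> k G k' q _; exact: double_sym.
- by move=> k G k' q _; exact: double_neq.
Defined.

Lemma ord2_neq (i i' : 'I_2) : i != i' -> i' = rev_ord i.
Proof.
move=> ii; apply: val_inj => /=; move: ii; rewrite -(inj_eq val_inj) /=.
by case: i i' => [k hk] [k' hk'] /=; lia.
Qed.

Lemma side_eq0 (R : realType) (i : 'I_2) (x : R) :
  side R i * x = side R (rev_ord i) * x -> x = 0.
Proof.
rewrite /side -!(inj_eq val_inj) /=; case: i => [[|[|//]] hk] /=; lra.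
Qed.

(** The cone block is the doubled tetrahedron that parametrizes the collar, the
    height being +-depth on the two copies. *)
Lemma cone_block_map (R : realType) : block_map R cone_block.
Proof.
pose nu (k : 'I_2) (w : pnt R) := side R k * depth w.
apply: (@block_map_core R cone_block nu (fun _ w => w)).
- by move=> k w; rewrite /nu normrM side_norm mul1r ger0_norm // depth_ge0.
- by move=> k; apply: contM; [exact: cont_cst|exact: depth_continuous].
- by move=> k w.
- by move=> w w1; split=> //=; rewrite /nu /side eqxx mul1r.
- move=> w w1; split=> /=; last first.
    rewrite /nu /side /= mulN1r; congr (- depth _).
    by apply: pnt_eq => v; rewrite bc_permute perm1.
  by apply: pnt_eq => v; rewrite bc_permute perm1.
- move=> [k w] [k' w'] [G [q [/cone_inner Go [<- <-] wG ww]]] /=.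
  have <- : w = w' by apply: pnt_eq => v; rewrite -ww perm1.
  by rewrite /nu (depth_face0 Go wG) !mulr0.
- move=> x t tx; case: (leP 0 t) => t0.
    exists (ord0, x); split=> //=; rewrite /nu /side eqxx mul1r -tx ger0_norm //.
  exists (ord_max, x); split=> //=; rewrite /nu /side /= mulN1r -tx ltr0_norm //.
  by rewrite opprK.
- move=> [k w] [k' w'] /= <-; have [->|kk] := eqVneq k k'; first by move=> _; exact: rst_refl.
  rewrite /nu => ss.
  have k'E : k' = rev_ord k := ord2_neq kk.
  have m0 : depth w = 0.
    by apply: (@side_eq0 R k); rewrite ss k'E.
  have [G Go wG] : exists2 G, G != o1 & bc w G = 0.
    by have [_ _ _ []] := depthP w; rewrite m0 => /esym; [exists o0|exists o2|exists o3].
  apply: rst_step; exists G, 1%g; split=> //.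
  + by apply/cone_inner.
  + by rewrite k'E.
  + by move=> v; rewrite perm1.
Qed.

(** * The page block *)

(** The cone block after a flip of type 2-3. Write A V B C and A' V B C for the
    two tetrahedra of the cone block; their union along V B C is divided into
    the three tetrahedra around the new edge A A'. In all three of them vertices
    0 and 1 are A and A'. In q0 the vertices 2 and 3 are B and C, in q1 they are
    B and V, in q2 they are V and C. The faces of q1 and q2 away from the edge A
    A' are folded together, as they were in the cone block; those of q0 are the
    free triangles. The last line also covers the free faces, where the value is
    meaningless. *)
Definition page_glue (k : 'I_3) (G : 'I_4) : 'I_3 * 'S_4 :=
  match val k, val G with
  | 0, 3 => (q1, 1%g)
  | 0, 2 => (q2, 1%g)
  | 1, 3 => (q0, 1%g)
  | 1, 2 => (q2, tperm o2 o3)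
  | 2, 3 => (q1, tperm o2 o3)
  | 2, 2 => (q0, 1%g)
  | _, _ => (k, tperm o0 o1)
  end.

Lemma page_free : (q0, o1) <> (q0, (tperm o0 o1 : 'S_4) o1).
Proof. by rewrite tpermR. Qed.

Definition page_inner (k : 'I_3) (G : 'I_4) :=
  (k, G) != (q0, o1) /\ (k, G) != (q0, (tperm o0 o1 : 'S_4) o1).

Lemma page_ind (P : 'I_3 -> 'I_4 -> 'I_3 -> 'S_4 -> Prop) :
  P q0 o3 q1 1%g -> P q0 o2 q2 1%g -> P q1 o3 q0 1%g ->
  P q1 o2 q2 (tperm o2 o3) -> P q2 o3 q1 (tperm o2 o3) -> P q2 o2 q0 1%g ->
  P q1 o0 q1 (tperm o0 o1) -> P q1 o1 q1 (tperm o0 o1) ->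
  P q2 o0 q2 (tperm o0 o1) -> P q2 o1 q2 (tperm o0 o1) ->
  forall k G k' q, page_inner k G -> page_glue k G = (k', q) -> P k G k' q.
Proof.
move=> h1 h2 h3 h4 h5 h6 h7 h8 h9 h10 k G k' q.
rewrite /page_inner tpermR.
move: k G; apply: ord3_ind; apply: ord4_ind => -[] //= _ _ [<- <-] //.
Qed.

Lemma page_inner_intro (k : 'I_3) (G : 'I_4) :
  (k != q0) || (1 < G)%N -> page_inner k G.
Proof.
rewrite /page_inner tpermR.
by move: k G; apply: ord3_ind; apply: ord4_ind.
Qed.

Definition page_block : block.
Proof.
refine (@Block 3 page_glue q0 q0 (tperm o0 o1) page_free _ _ _).
- apply: page_ind; apply: page_inner_intro; by rewrite ?perm1 ?tpermL ?tpermR.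
- by apply: page_ind; rewrite ?perm1 ?tpermL ?tpermR ?tpermV ?invg1.
- by apply: page_ind; rewrite ?perm1 ?tpermL ?tpermR.
Defined.

Section PageMap.
Variable R : realType.
Local Notation pnt := (pnt R).

(** In the union of the two old tetrahedra the edge A A' crosses the triangle V
    B C at its barycentre, so that the midpoint of A A' has the coordinates 1/3,
    1/3, 1/3 there. A point with coordinates w0 and w1 at A and A' has the
    coordinate |w0 - w1| at A or A', and the remaining weight 2 min(w0, w1) is
    divided evenly between V, B and C. *)
Definition page_min (w : pnt) : R := 2 / 3 * Num.min (bc w o0) (bc w o1).
Definition page_gap (w : pnt) : R := `|bc w o0 - bc w o1|.

Lemma page_minP w : [/\ 0 <= page_min w, 0 <= page_gap w &
  [\/ [/\ bc w o1 <= bc w o0, 2 * bc w o1 = 3 * page_min w & page_gap w = bc w o0 - bc w o1]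
   | [/\ bc w o0 <= bc w o1, 2 * bc w o0 = 3 * page_min w & page_gap w = bc w o1 - bc w o0]]].
Proof.
have x0 := bc_ge0 w o0; have x1 := bc_ge0 w o1; rewrite /page_min /page_gap.
case: (leP (bc w o0) (bc w o1)) => h.
  rewrite ler0_norm; last by lra.
  by split; [lra|lra|right; split; lra].
rewrite gtr0_norm; last by lra.
by split; [lra|lra|left; split; lra].
Qed.

Definition page_V (k : 'I_3) (w : pnt) : R :=
  match val k with 0 => 0 | 1 => bc w o3 | _ => bc w o2 end + page_min w.
Definition page_B (k : 'I_3) (w : pnt) : R :=
  match val k with 0 => bc w o2 | 1 => bc w o2 | _ => 0 end + page_min w.
Definition page_C (k : 'I_3) (w : pnt) : R :=
  match val k with 0 => bc w o3 | 1 => 0 | _ => bc w o3 end + page_min w.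

(** The point of the tetrahedron A V B C with the given old coordinates, the two
    copies being identified. *)
Definition page_foot (k : 'I_3) (w : pnt) : pnt :=
  mkpt (page_gap w) (page_V k w) (page_B k w) (page_C k w).
(** The sign of w0 - w1 selects the copy; the absolute value must be the depth,
    that is, min(|w0 - w1|, B, C). *)
Definition page_height (k : 'I_3) (w : pnt) : R :=
  clamp (Num.min (page_B k w) (page_C k w)) (bc w o0 - bc w o1).

Lemma page_footE k w : [/\ bc (page_foot k w) o0 = page_gap w, bc (page_foot k w) o1 = page_V k w,
  bc (page_foot k w) o2 = page_B k w & bc (page_foot k w) o3 = page_C k w].
Proof.
have x2 := bc_ge0 w o2; have x3 := bc_ge0 w o3; have xs := bc_sum w.
have [m0 a0 M] := page_minP w.
apply: mkptE => //; rewrite /page_V /page_B /page_C; move: k; apply: ord3_ind => /=;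
  by case: M => -[]; lra.
Qed.

Lemma page_VBC_ge0 k w : [/\ 0 <= page_V k w, 0 <= page_B k w & 0 <= page_C k w].
Proof. by have [_ <- <- <-] := page_footE k w; rewrite !bc_ge0. Qed.

Lemma page_heightE k w : `|page_height k w| = depth (page_foot k w).
Proof.
have [_ b0 c0] := page_VBC_ge0 k w.
rewrite /depth /page_height norm_clamp ?le_min ?b0 ?c0 //; have [-> _ -> ->] := page_footE k w.
by rewrite -/(page_gap w) minC.
Qed.

Lemma page_min_continuous : continuous page_min.
Proof.
by apply: contM; [exact: cont_cst|apply: cont_min; exact: bc_continuous].
Qed.

Lemma wdiff_continuous : continuous (fun w : pnt => bc w o0 - bc w o1).
Proof. by apply: contB; exact: bc_continuous. Qed.

Lemma page_B_continuous k : continuous (page_B k).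
Proof.
rewrite /page_B; apply: contD; last exact: page_min_continuous.
by case: (val k) => [|[|?]]; [exact: bc_continuous|exact: bc_continuous|exact: cont_cst].
Qed.

Lemma page_V_continuous k : continuous (page_V k).
Proof.
rewrite /page_V; apply: contD; last exact: page_min_continuous.
by case: (val k) => [|[|?]]; [exact: cont_cst|exact: bc_continuous|exact: bc_continuous].
Qed.

Lemma page_C_continuous k : continuous (page_C k).
Proof.
rewrite /page_C; apply: contD; last exact: page_min_continuous.
by case: (val k) => [|[|?]]; [exact: bc_continuous|exact: cont_cst|exact: bc_continuous].
Qed.

Lemma page_foot_continuous k : continuous (page_foot k).
Proof.
apply: continuous_pnt; apply: ord4_ind.
- rewrite (_ : (fun w => _) = page_gap); first exact: (cont_norm wdiff_continuous).
  by apply: boolp.funext => w; have [-> _ _ _] := page_footE k w.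
- rewrite (_ : (fun w => _) = page_V k); first exact: page_V_continuous.
  by apply: boolp.funext => w; have [_ -> _ _] := page_footE k w.
- rewrite (_ : (fun w => _) = page_B k); first exact: page_B_continuous.
  by apply: boolp.funext => w; have [_ _ -> _] := page_footE k w.
- rewrite (_ : (fun w => _) = page_C k); first exact: page_C_continuous.
  by apply: boolp.funext => w; have [_ _ _ ->] := page_footE k w.
Qed.

Lemma page_height_continuous k : continuous (page_height k).
Proof.
have kc : continuous (fun w => Num.min (page_B k w) (page_C k w)).
  by apply: cont_min; [exact: page_B_continuous|exact: page_C_continuous].
apply: cont_max; first exact: contN.
by apply: cont_min => //; exact: wdiff_continuous.
Qed.

Lemma clamp0 (c : R) : clamp 0 c = 0.
Proof. by rewrite /clamp oppr0 ; case: (leP 0 c) => h; rewrite ?maxxx // (max_idPl _) // ltW. Qed.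

Lemma page_map_inner (c d : 'I_3 * pnt) : @bstep R page_block c d ->
  page_foot c.1 c.2 = page_foot d.1 d.2 /\ page_height c.1 c.2 = page_height d.1 d.2.
Proof.
case: c d => [k w] [k' w'] [G [q [kG /= e wG ww]]]; move: k G k' q kG e wG ww.
suff H : forall k G k' (q : 'S_4), page_inner k G -> page_glue k G = (k', q) ->
  bc w G = 0 -> (forall v, bc w' (q v) = bc w v) ->
  [/\ page_gap w = page_gap w', page_V k w = page_V k' w', page_B k w = page_B k' w', page_C k w = page_C k' w' &
    page_height k w = page_height k' w'].
  move=> k G k' q kG e wG ww; have [e1 e2 e3 e4 e5] := H _ _ _ _ kG e wG ww.
  by rewrite /page_foot e1 e2 e3 e4.
apply: page_ind => wG ww; have e0 := ww o0; have e1 := ww o1; have e2 := ww o2;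
  have e3 := ww o3; rewrite ?perm1 ?tpermL ?tpermR ?tpermD // in e0 e1 e2 e3.
all: rewrite /page_height /page_gap /page_V /page_B /page_C /page_min /= ?e0 ?e1 ?e2 ?e3 ?wG ?add0r.
all: try by split.
all: rewrite ?sub0r ?subr0 ?normrN.
all: rewrite !(min_l (bc_ge0 w _)) !(min_r (bc_ge0 w _)) mulr0 !addr0.
all: rewrite ?(min_l (bc_ge0 w _)) ?(min_r (bc_ge0 w _)) ?clamp0.
all: by split.
Qed.

Lemma clamp_pos (k c : R) : 0 <= k -> 0 <= c -> clamp k c = Num.min k c.
Proof.
by move=> k0 c0; rewrite /clamp (max_idPr _) // le_min; apply/andP; split; lra.
Qed.

Lemma clamp_neg (k c : R) : 0 <= k -> 0 <= c -> clamp k (- c) = - Num.min k c.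
Proof.
move=> k0 c0; rewrite /clamp (min_r (x := k)); last by lra.
by rewrite /Order.max /Order.min; case: (ltP k c) => ?; case: ltP => ?; lra.
Qed.

Lemma page_map_front w : bc w o1 = 0 -> page_foot q0 w = w /\ page_height q0 w = depth w.
Proof.
move=> w1; have w0 := bc_ge0 w o0.
have wm : page_min w = 0 by rewrite /page_min w1 min_r // mulr0.
have [e0 e1 e2 e3] := page_footE q0 w.
rewrite /page_gap /page_V /page_B /page_C wm !addr0 w1 subr0 ger0_norm //= in e0 e1 e2 e3.
split.
  by apply: pnt_eq; apply: ord4_ind; rewrite ?e0 ?e1 ?e2 ?e3 ?w1.
rewrite /page_height /page_B /page_C wm !addr0 w1 subr0 /= clamp_pos ?le_min ?bc_ge0 //.
by rewrite /depth minC.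
Qed.

Lemma page_map_back w : bc w ((tperm o0 o1 : 'S_4) o1) = 0 ->
  page_foot q0 w = permute (tperm o0 o1) w /\
  page_height q0 w = - depth (permute (tperm o0 o1) w).
Proof.
rewrite tpermR => w0; have w1 := bc_ge0 w o1.
have wm : page_min w = 0 by rewrite /page_min w0 min_l // mulr0.
have [e0 e1 e2 e3] := page_footE q0 w.
rewrite /page_gap /page_V /page_B /page_C wm !addr0 w0 sub0r normrN ger0_norm //= in e0 e1 e2 e3.
split.
  by apply: pnt_eq; apply: ord4_ind;
    rewrite ?e0 ?e1 ?e2 ?e3 bc_permute ?tpermL ?tpermR ?tpermD.
rewrite /page_height /page_B /page_C wm !addr0 w0 sub0r /= clamp_neg ?le_min ?bc_ge0 //.
by rewrite /depth !bc_permute tpermL ?tpermD // minC.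
Qed.

Lemma page_point (d x0 x2 x3 : R) (neg : bool) :
  0 <= d -> 0 <= x0 -> 0 <= x2 -> 0 <= x3 -> d + 3 * x0 + x2 + x3 = 1 ->
  exists w, [/\ bc w o0 - bc w o1 = if neg then - d else d, page_gap w = d,
    page_min w = x0, bc w o2 = x2 & bc w o3 = x3].
Proof.
move=> d0 x00 x20 x30 xs.
(* the factor undoes the 2/3 of page_min *)
pose lo := 3 / 2 * x0; pose hi := d + 3 / 2 * x0.
have [e0 e1 e2 e3] : [/\ bc (mkpt (if neg then lo else hi) (if neg then hi else lo) x2 x3) o0
   = if neg then lo else hi,
   bc (mkpt (if neg then lo else hi) (if neg then hi else lo) x2 x3) o1
   = if neg then hi else lo,
   bc (mkpt (if neg then lo else hi) (if neg then hi else lo) x2 x3) o2 = x2 &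
   bc (mkpt (if neg then lo else hi) (if neg then hi else lo) x2 x3) o3 = x3].
  by apply: mkptE => //; rewrite /lo /hi; case: neg; lra.
exists (mkpt (if neg then lo else hi) (if neg then hi else lo) x2 x3).
split=> //; rewrite ?/page_gap ?/page_min e0 e1 /lo /hi; case: neg {e0 e1 e2 e3}.
- lra.
- lra.
- by rewrite ler0_norm; lra.
- by rewrite ger0_norm; lra.
- by rewrite min_l; lra.
- by rewrite min_r; lra.
Qed.

(** The tetrahedron to be used is the one that misses the vertex among V, B, C
    with the smallest coordinate. *)
Lemma page_map_surj (x : pnt) t : `|t| = depth x ->
  exists c : 'I_3 * pnt, page_foot c.1 c.2 = x /\ page_height c.1 c.2 = t.
Proof.
move=> tx; pose r := Num.min (bc x o1) (Num.min (bc x o2) (bc x o3)).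
have [r1 r2 r3 rE] : [/\ r <= bc x o1, r <= bc x o2, r <= bc x o3 &
  [\/ r = bc x o1, r = bc x o2 | r = bc x o3]] := min3P _ _ _.
have r0 : 0 <= r by case: rE => ->; exact: bc_ge0.
have x0 := bc_ge0 x o0; have xs := bc_sum x.
suff [k [w [dw aw Vw Bw Cw]]] : exists k w,
    [/\ bc w o0 - bc w o1 = if t < 0 then - bc x o0 else bc x o0,
      page_gap w = bc x o0, page_V k w = bc x o1, page_B k w = bc x o2 & page_C k w = bc x o3].
  exists (k, w); split=> /=.
    have [e0 e1 e2 e3] := page_footE k w.
    by apply: pnt_eq; apply: ord4_ind; rewrite ?e0 ?e1 ?e2 ?e3.
  have b0 : 0 <= Num.min (bc x o2) (bc x o3) by rewrite le_min !bc_ge0.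
  have mE : depth x = Num.min (Num.min (bc x o2) (bc x o3)) (bc x o0) by rewrite minC.
  rewrite /page_height dw Bw Cw; case: (ltP t 0) tx => t0 tx.
    by rewrite clamp_neg // -mE -tx ltr0_norm // opprK.
  by rewrite clamp_pos // -mE -tx ger0_norm.
case: rE => rE.
- have [|||||w [dw aw mw w2 w3]] := @page_point (bc x o0) r (bc x o2 - r) (bc x o3 - r) (t < 0);
    [lra..|].
  by exists q0, w; split; rewrite // /page_V /page_B /page_C /= mw ?w2 ?w3; lra.
- have [|||||w [dw aw mw w2 w3]] := @page_point (bc x o0) r (bc x o1 - r) (bc x o3 - r) (t < 0);
    [lra..|].
  by exists q2, w; split; rewrite // /page_V /page_B /page_C /= mw ?w2 ?w3; lra.
- have [|||||w [dw aw mw w2 w3]] := @page_point (bc x o0) r (bc x o2 - r) (bc x o1 - r) (t < 0);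
    [lra..|].
  by exists q1, w; split; rewrite // /page_V /page_B /page_C /= mw ?w2 ?w3; lra.
Qed.

Lemma page_step (k k' : 'I_3) (G : 'I_4) (q : 'S_4) (w w' : pnt) :
  (k != q0) || (1 < G)%N -> page_glue k G = (k', q) -> bc w G = 0 ->
  (forall v, bc w' (q v) = bc w v) -> @bequiv R page_block (k, w) (k', w').
Proof.
move=> kG e wG ww; apply: rst_step; exists G, q; split=> //.
exact: page_inner_intro.
Qed.

(** On the same side, the three tetrahedra overlap only along their common
    faces. *)
Lemma page_same_order (k k' : 'I_3) (w w' : pnt) : page_min w = page_min w' ->
  bc w o0 = bc w' o0 -> bc w o1 = bc w' o1 ->
  page_V k w = page_V k' w' -> page_B k w = page_B k' w' -> page_C k w = page_C k' w' ->
  @bequiv R page_block (k, w) (k', w').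
Proof.
rewrite /page_V /page_B /page_C => <- e0 e1 /addIr eV /addIr eB /addIr eC.
have same : bc w o2 = bc w' o2 -> bc w o3 = bc w' o3 -> w = w'.
  by move=> e2 e3; apply: pnt_eq; apply: ord4_ind.
have swap : bc w' o2 = bc w o3 -> bc w' o3 = bc w o2 ->
    forall v, bc w' ((tperm o2 o3 : 'S_4) v) = bc w v.
  by move=> e2 e3; apply: ord4_ind; rewrite ?tpermL ?tpermR ?tpermD.
move: k k' eV eB eC; apply: ord3_ind; apply: ord3_ind => /= eV eB eC.
- by rewrite same //; exact: rst_refl.
- rewrite same //; last by rewrite eC -eV.
  by apply: (@page_step _ _ o3 1%g) => // v; rewrite perm1.
- rewrite same //; last by rewrite eB -eV.
  by apply: (@page_step _ _ o2 1%g) => // v; rewrite perm1.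
- rewrite same //; last by rewrite eV -eC.
  by apply: (@page_step _ _ o3 1%g) => // v; rewrite perm1.
- by rewrite same //; exact: rst_refl.
- by apply: (@page_step _ _ o2 (tperm o2 o3)) => //; apply: swap; rewrite // eB eC.
- rewrite same //; last by rewrite eV -eB.
  by apply: (@page_step _ _ o2 1%g) => // v; rewrite perm1.
- by apply: (@page_step _ _ o3 (tperm o2 o3)) => //; apply: swap; rewrite // -?eB eC.
- by rewrite same //; exact: rst_refl.
Qed.

(** The faces of q1 and q2 away from the edge A A' are folded onto each other by
    exchanging A and A'. *)
Lemma page_fold (k : 'I_3) (u : pnt) : k != q0 -> page_min u = 0 ->
  @bequiv R page_block (k, u) (k, permute (tperm o0 o1) u).
Proof.
move=> k0; have [_ _ M] := page_minP u => u0.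
have uE v : bc (permute (tperm o0 o1) u) ((tperm o0 o1 : 'S_4) v) = bc u v.
  by rewrite bc_permute tpermK.
move: k k0; apply: ord3_ind => // _.
- by case: M => -[_ + _]; rewrite u0 mulr0 => /eqP; rewrite mulf_eq0 pnatr_eq0 => /eqP h;
    [apply: (@page_step _ _ o1 (tperm o0 o1))|apply: (@page_step _ _ o0 (tperm o0 o1))].
- by case: M => -[_ + _]; rewrite u0 mulr0 => /eqP; rewrite mulf_eq0 pnatr_eq0 => /eqP h;
    [apply: (@page_step _ _ o1 (tperm o0 o1))|apply: (@page_step _ _ o0 (tperm o0 o1))].
Qed.

(** The points lie on different sides and over the same point of a folded face.
    Both can be moved into q1 or q2, by [page_same_order], and are exchanged
    there by [page_fold]. *)
Lemma page_swapped (k k' : 'I_3) (w w' : pnt) : page_min w = 0 -> page_min w' = 0 ->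
  bc w o0 = bc w' o1 -> bc w o1 = bc w' o0 ->
  page_V k w = page_V k' w' -> page_B k w = page_B k' w' -> page_C k w = page_C k' w' ->
  page_B k w = 0 \/ page_C k w = 0 -> @bequiv R page_block (k, w) (k', w').
Proof.
move=> m0 m0' d0 d1 eV eB eC BC.
have [j [u [j0 [u0 u1 uV uB uC]]]] : exists (j : 'I_3) u, j != q0 /\
    [/\ bc u o0 = bc w o0, bc u o1 = bc w o1, page_V j u = page_V k w, page_B j u = page_B k w &
     page_C j u = page_C k w].
  have [V0 B0 C0] := page_VBC_ge0 k w; have [a0 aV aB aC] := page_footE k w.
  have := bc_sum (page_foot k w); rewrite a0 aV aB aC => xs.
  have [_ _ M] := page_minP w; have x0 := bc_ge0 w o0; have x1 := bc_ge0 w o1.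
  have wm : Num.min (bc w o0) (bc w o1) = 0 by move: m0; rewrite /page_min; lra.
  case: BC => Z.
    have [||||| e0 e1 e2 e3] := @mkptE R (bc w o0) (bc w o1) (page_V k w) (page_C k w) => //.
      by case: M => -[]; lra.
    exists q2, (mkpt (bc w o0) (bc w o1) (page_V k w) (page_C k w)); split=> //.
    set u := mkpt _ _ _ _ in e0 e1 e2 e3 *.
    have um : page_min u = 0 by rewrite /page_min e0 e1 wm mulr0.
    split=> //.
    - by change (bc u o2 + page_min u = page_V k w); rewrite e2 um addr0.
    - by change (0 + page_min u = page_B k w); rewrite um addr0 Z.
    - by change (bc u o3 + page_min u = page_C k w); rewrite e3 um addr0.
  have [||||| e0 e1 e2 e3] := @mkptE R (bc w o0) (bc w o1) (page_B k w) (page_V k w) => //.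
    by case: M => -[]; lra.
  exists q1, (mkpt (bc w o0) (bc w o1) (page_B k w) (page_V k w)); split=> //.
  set u := mkpt _ _ _ _ in e0 e1 e2 e3 *.
  have um : page_min u = 0 by rewrite /page_min e0 e1 wm mulr0.
  split=> //.
  - by change (bc u o3 + page_min u = page_V k w); rewrite e3 um addr0.
  - by change (bc u o2 + page_min u = page_B k w); rewrite e2 um addr0.
  - by change (0 + page_min u = page_C k w); rewrite um addr0 Z.
have um : page_min u = 0 by rewrite -m0 /page_min u0 u1.
have um' : page_min (permute (tperm o0 o1) u) = 0.
  by rewrite -um /page_min !bc_permute tpermL tpermR minC.
have [v2 v3] : bc (permute (tperm o0 o1) u) o2 = bc u o2 /\
               bc (permute (tperm o0 o1) u) o3 = bc u o3.
  by rewrite !bc_permute !tpermD.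
apply: rst_trans (rst_trans _ _ _ _ _ (page_fold j0 um) _).
  by apply: page_same_order; rewrite ?um ?m0.
apply: page_same_order; rewrite ?um' ?m0' ?bc_permute ?tpermL ?tpermR ?u0 ?u1 //.
- by rewrite -eV -uV /page_V v2 v3 um um'.
- by rewrite -eB -uB /page_B v2 um um'.
- by rewrite -eC -uC /page_C v3 um um'.
Qed.

(** Equal feet leave two possibilities: the points lie on the same side, or on
    opposite sides with height zero, which forces them to lie over a face B = 0
    or C = 0. *)
Lemma page_map_inj (c d : 'I_3 * pnt) : page_foot c.1 c.2 = page_foot d.1 d.2 ->
  page_height c.1 c.2 = page_height d.1 d.2 -> @bequiv R page_block c d.
Proof.
case: c d => [k w] [k' w'] /= ex en.
have [a0 aV aB aC] := page_footE k w; have [b0 bV bB bC] := page_footE k' w'.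
rewrite {}ex in a0 aV aB aC; have eA : page_gap w = page_gap w' by rewrite -a0.
have eV : page_V k w = page_V k' w' by rewrite -aV.
have eB : page_B k w = page_B k' w' by rewrite -aB.
have eC : page_C k w = page_C k' w' by rewrite -aC.
have eM : page_min w = page_min w'.
  have := bc_sum w; have := bc_sum w'; have [_ _ M] := page_minP w; have [_ _ M'] := page_minP w'.
  have x2 := bc_ge0 w o2; have x3 := bc_ge0 w o3.
  have x2' := bc_ge0 w' o2; have x3' := bc_ge0 w' o3.
  move: eV eB eC; rewrite /page_V /page_B /page_C; move: k k' {a0 aV aB aC b0 bV bB bC en}.
  by apply: ord3_ind; apply: ord3_ind => /= *; lra.
have [m0 r0 M] := page_minP w; have [_ _ M'] := page_minP w'.
have [same|diff] : (bc w o0 = bc w' o0 /\ bc w o1 = bc w' o1) \/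
   (bc w o0 = bc w' o1 /\ bc w o1 = bc w' o0 /\ bc w o0 <> bc w o1).
  have [e|ne] := eqVneq (bc w o0) (bc w o1).
    by left; case: M => -[]; case: M' => -[]; lra.
  case: M => -[h1 h2 h3]; case: M' => -[h4 h5 h6]; try by left; lra.
    by right; split; [lra|split; [lra|exact/eqP]].
  by right; split; [lra|split; [lra|exact/eqP]].
  by apply: page_same_order => //; case: same.
have [d0 [d1 dn]] := diff; have [V0 B0 C0] := page_VBC_ge0 k w.
have K0 : Num.min (page_B k w) (page_C k w) = 0.
  have K0 : 0 <= Num.min (page_B k w) (page_C k w) by rewrite le_min B0 C0.
  move: en; rewrite /page_height -eB -eC -d0 -d1; move: K0; set K := Num.min _ _ => K0.
  have [h|h|h] := ltgtP (bc w o1) (bc w o0); last by case: dn.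
    rewrite -(opprB (bc w o0)) clamp_pos ?clamp_neg ?subr_ge0 ?(ltW h) // /Order.min.
    by case: ltP => ?; lra.
  rewrite -(opprB (bc w o1)) clamp_neg ?clamp_pos ?subr_ge0 ?(ltW h) // /Order.min.
  by case: ltP => ?; lra.
have BC : page_B k w = 0 \/ page_C k w = 0.
  by move: K0; case: leP => _ ->; [left|right].
have wm0 : page_min w = 0.
  have x2 := bc_ge0 w o2; have x3 := bc_ge0 w o3.
  move: BC; rewrite /page_B /page_C; move: k {a0 aV aB aC eV eB eC en V0 B0 C0 K0}.
  by apply: ord3_ind => /= -[]; lra.
by apply: page_swapped; rewrite // -?eM.
Qed.

Lemma page_block_map : block_map R page_block.
Proof.
apply: (@block_map_core R page_block page_height page_foot).
- exact: page_heightE.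
- exact: page_height_continuous.
- exact: page_foot_continuous.
- exact: page_map_front.
- exact: page_map_back.
- exact: page_map_inner.
- exact: page_map_surj.
- exact: page_map_inj.
Qed.

End PageMap.

(** * Surfaces with a single quadrilateral type *)

(** The partner in the splitting of the four vertices into 01 and 23. *)
Definition mate (v : 'I_4) : 'I_4 :=
  match val v with 0 => o1 | 1 => o0 | 2 => o3 | _ => o2 end.

Section Thin.
Variable R : realType.

(** A surface is encoded by its triangle coordinates c i (Some v) and the
    coordinate c i None of its quadrilaterals of type 01|23, all other
    quadrilateral coordinates being zero. [narc c i F v] counts its arcs around
    the corner v in face F. *)
Definition narc n (c : 'I_n -> option 'I_4 -> R) (i : 'I_n) (F v : 'I_4) : R :=
  c i (Some v) + (if F == mate v then c i None else 0).

Definition thin_matching n (T : gluing n) (c : 'I_n -> option 'I_4 -> R) :=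
  forall i F j p, glue T i F = (j, p) -> forall v, v != F ->
    narc c i F v = narc c j (p F) (p v).

Definition supported n (c' c : 'I_n -> option 'I_4 -> R) :=
  forall i o, c i o = 0 -> c' i o = 0.

Definition proportional n (c' c : 'I_n -> option 'I_4 -> R) (t : R) :=
  forall i o, c' i o = t * c i o.

(** The condition for being a vertex of the projective solution space;
    positivity is a separate matter. *)
Definition rigid n (T : gluing n) (c : 'I_n -> option 'I_4 -> R) :=
  thin_matching T c /\ forall c', thin_matching T c' -> supported c' c ->
    exists t, proportional c' c t.

Lemma narc_proportional n (c' c : 'I_n -> option 'I_4 -> R) t i F v :
  proportional c' c t -> narc c' i F v = t * narc c i F v.
Proof. by move=> h; rewrite /narc !h; case: ifP => _; ring. Qed.

Definition block_matching (B : block) (d : 'I_(bsize B) -> option 'I_4 -> R) :=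
  forall k G k' q, binner k G -> bglue k G = (k', q) -> forall v, v != G ->
    narc d k G v = narc d k' (q G) (q v).

(** From outside, a block with this property is invisible to surfaces: they
    leave it at the back triangle as they enter it at the front. *)
Definition parallel (B : block) :=
  forall d, block_matching d -> forall v, v != o1 ->
    narc d (bback B) (btau B o1) (btau B v) = narc d (bfront B) o1 v.

Section Insert.
Variables (n : nat) (T : gluing n) (B : block) (i : 'I_n) (a : 'S_4).
Hypothesis parB : parallel B.
Local Notation m := (bsize B).
Local Notation T' := (insert T B i a).
Local Notation F := (ins_face a).
Local Notation j := (glue T i F).1.
Local Notation p := (glue T i F).2.

Definition lpart (e : 'I_(n + m) -> option 'I_4 -> R) l := e (lshift m l).
Definition rpart (e : 'I_(n + m) -> option 'I_4 -> R) k := e (rshift n k).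
Definition join (c : 'I_n -> option 'I_4 -> R) (d : 'I_m -> option 'I_4 -> R)
    (u : 'I_(n + m)) : option 'I_4 -> R :=
  match fintype.split u with inl l => c l | inr k => d k end.

Lemma lpart_join c d : lpart (join c d) = c.
Proof.
by apply: boolp.funext => l; rewrite /lpart /join -/(unsplit (inl l)) unsplitK.
Qed.

Lemma rpart_join c d : rpart (join c d) = d.
Proof.
by apply: boolp.funext => k; rewrite /rpart /join -/(unsplit (inr k)) unsplitK.
Qed.

Definition fits (c : 'I_n -> option 'I_4 -> R) (d : 'I_m -> option 'I_4 -> R) :=
  forall v, v != o1 -> narc d (bfront B) o1 v = narc c i F (a^-1%g v).

Definition part_narc (e : 'I_(n + m) -> option 'I_4 -> R) (s : 'I_n + 'I_m) :=
  match s with inl l => narc (lpart e) l | inr k => narc (rpart e) k end.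

Lemma narc_unsplit e s : narc e (unsplit s) = part_narc e s.
Proof. by case: s. Qed.

Lemma thin_insertE e : thin_matching T' e <->
  forall s G s' q, ins_glue T i a s G = (s', q) -> forall v, v != G ->
    part_narc e s G v = part_narc e s' (q G) (q v).
Proof.
split=> h.
  move=> s G s' q e1 v vG; have := h (unsplit s) G (unsplit s') q _ v vG.
  by rewrite !narc_unsplit; apply; apply/insertP; rewrite !unsplitK.
move=> u G u' q /insertP e1 v vG.
by rewrite -(splitK u) -(splitK u') !narc_unsplit; exact: h e1 v vG.
Qed.

Let glue_ij : glue T i F = (j, p).
Proof. by case: (glue T i F). Qed.

(** A surface in the enlarged triangulation is still a surface in the old one
    when the block is removed: across the opened face, the arcs agree because
    they agree on the two free triangles. *)
Lemma thin_restrict e : thin_matching T' e ->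
  [/\ thin_matching T (lpart e), block_matching (rpart e) &
      fits (lpart e) (rpart e)].
Proof.
move/thin_insertE => h.
have bm : block_matching (rpart e).
  move=> k G k' q [/negbTE kf /negbTE kb] kq v vG.
  by have := h (inr k) G (inr k') q; rewrite /= kf kb kq; apply.
have ft : fits (lpart e) (rpart e).
  move=> v v1; have := h (inl i) F (inr (bfront B)) a; rewrite /= eqxx.
  move=> /(_ erefl (a^-1%g v)); rewrite ins_faceK permKV => -> //.
  by apply: contra_neq v1 => vF; rewrite -(ins_faceK a) -vF permKV.
(* front triangle, through the block, back triangle *)
have cross v : v != F -> narc (lpart e) i F v = narc (lpart e) j (p F) (p v).
  move=> vF; have aF : a v != o1 by rewrite -(ins_faceK a) (inj_eq perm_inj).
  rewrite -{1}(permK a v) -ft // -(parB bm aF) -{1}(ins_faceK a).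
  rewrite -!(ins_backE T B i a).
  have := h (inl j) (p F) (inr (bback B)) (ins_back T B i a).
  rewrite /=; case: eqP => [/(glue_neq glue_ij)//|_]; rewrite eqxx.
  by move=> /(_ erefl (p v)) -> //; rewrite (inj_eq perm_inj).
split=> // l G l' q lq v vG.
have [E|li] := eqVneq (l, G) (i, F).
  case: E => El EG; subst l G.
  by move: lq; rewrite glue_ij => -[<- <-]; exact: cross.
have [E|lj] := eqVneq (l, G) (j, p F).
  case: E => El EG; subst l G.
  move: lq; rewrite (glue_sym glue_ij) => -[<- <-].
  rewrite permK cross ?permKV // -(inj_eq (@perm_inj _ p)) permKV //.
have := h (inl l) G (inl l') q.
by rewrite /= (negbTE li) (negbTE lj) lq; apply.
Qed.

Lemma thin_extend c d : thin_matching T c -> block_matching d -> fits c d ->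
  thin_matching T' (join c d).
Proof.
move=> cm dm ft; apply/thin_insertE => s G s' q.
have front v : v != F -> narc c i F v = narc d (bfront B) (a F) (a v).
  move=> vF; rewrite ins_faceK ft ?permK //.
  by rewrite -(ins_faceK a) (inj_eq perm_inj).
have back v : v != p F -> narc c j (p F) v =
    narc d (bback B) (ins_back T B i a (p F)) (ins_back T B i a v).
  move=> vF; rewrite -{1 2}(permKV p v) !ins_backE.
  have vF' : p^-1%g v != F by rewrite -(inj_eq (@perm_inj _ p)) permKV.
  have aF : a (p^-1%g v) != o1 by rewrite -(ins_faceK a) (inj_eq perm_inj).
  rewrite ins_faceK parB // ft // permK.
  by rewrite (cm _ _ _ _ glue_ij _ vF').
case: s => [l|k]; rewrite /ins_glue.
  case: eqVneq => [[-> ->] [<- <-] v vG|li].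
    by rewrite /= lpart_join rpart_join front.
  case: eqVneq => [[-> ->] [<- <-] v vG|lj [<- <-] v vG].
    by rewrite /= lpart_join rpart_join back.
  rewrite /= lpart_join; apply: cm => //; by case: (glue T l G).
case: eqVneq => [[-> ->] [<- <-] v vG|kf].
  rewrite /= lpart_join rpart_join -/F front ?permKV ?ins_faceK //.
  by rewrite -(inj_eq (@perm_inj _ a)) permKV ins_faceK.
case: eqVneq => [[-> ->] [<- <-] v vG|kb [<- <-] v vG].
  have bE : (ins_back T B i a)^-1%g (btau B o1) = p F.
    by rewrite -{1}(ins_faceK a) -(ins_backE T B i a) permK.
  rewrite /= lpart_join rpart_join bE back ?permKV.
    by rewrite ins_backE ins_faceK.
  by rewrite -bE (inj_eq perm_inj).
rewrite /= rpart_join; apply: dm => //; by case: (bglue k G).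
Qed.

Lemma supported_lpart e c d : supported e (join c d) -> supported (lpart e) c.
Proof. by move=> h l o; rewrite -(lpart_join c d); exact: h. Qed.

Lemma supported_rpart e c d : supported e (join c d) -> supported (rpart e) d.
Proof. by move=> h l o; rewrite -(rpart_join c d); exact: h. Qed.

Lemma proportional_join e c d t : proportional (lpart e) c t ->
  proportional (rpart e) d t -> proportional e (join c d) t.
Proof.
move=> lc rd u o; rewrite -(splitK u) /join unsplitK.
by case: (fintype.split u) => [l|k]; [exact: lc|exact: rd].
Qed.

(** What a filling must satisfy for an insertion to preserve rigidity, as
    [rigid_insert] shows. *)
Definition determined (d : 'I_m -> option 'I_4 -> R) :=
  forall d' t, block_matching d' -> supported d' d ->
    (forall v, v != o1 -> narc d' (bfront B) o1 v = t * narc d (bfront B) o1 v) ->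
    proportional d' d t.

Lemma determined_join e c d t : block_matching d -> determined d -> fits c d ->
  thin_matching T' e -> supported e (join c d) ->
  proportional (lpart e) c t -> proportional e (join c d) t.
Proof.
move=> dm dd ft /thin_restrict [_ rm fe] es lc; apply: proportional_join => //.
apply: dd => //; first exact: supported_rpart es.
by move=> v v1; rewrite fe // ft // (narc_proportional _ _ _ lc).
Qed.

Lemma rigid_insert c d : rigid T c -> block_matching d -> determined d ->
  fits c d -> rigid T' (join c d).
Proof.
move=> [cm cr] dm dd ft; split; first exact: thin_extend.
move=> e em es; have [lm _ _] := thin_restrict em.
have [t lc] := cr _ lm (supported_lpart es).
by exists t; exact: determined_join lc.
Qed.

Lemma narc_lpart e l : narc e (lshift m l) = narc (lpart e) l.
Proof. by []. Qed.

Lemma narc_join_l c d l : narc (join c d) (lshift m l) = narc c l.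
Proof. by rewrite narc_lpart lpart_join. Qed.

End Insert.
End Thin.

(** * Fillings of the blocks *)

Section BlockSurfaces.
Variable R : realType.

Definition tet_vec (x0 x1 x2 x3 y : nat) (o : option 'I_4) : nat :=
  if o is Some v then nth 0 [:: x0; x1; x2; x3] (val v) else y.

Lemma tet_vec_ind (P : option 'I_4 -> Prop) :
  P None -> P (Some o0) -> P (Some o1) -> P (Some o2) -> P (Some o3) ->
  forall o, P o.
Proof. by move=> ? ? ? ? ? [v|//]; move: v; apply: ord4_ind. Qed.

(** The quadrilateral 01|23 contributes no arc around A or A' in a face
    containing the edge A A', and one arc around the third corner of that face. *)
Lemma page_matchingE (d : 'I_3 -> option 'I_4 -> R) :
  @block_matching R page_block d <->
  [/\ d q0 (Some o0) = d q0 (Some o1), d q1 (Some o0) = d q0 (Some o0) /\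
      d q1 (Some o1) = d q0 (Some o0), d q2 (Some o0) = d q0 (Some o0) /\
      d q2 (Some o1) = d q0 (Some o0) &
      [/\ d q0 (Some o2) + d q0 None = d q1 (Some o2) + d q1 None,
          d q1 (Some o3) + d q1 None = d q2 (Some o2) + d q2 None &
          d q2 (Some o3) + d q2 None = d q0 (Some o3) + d q0 None]].
Proof.
split.
  move=> h.
  have H k G k' q : page_inner k G -> page_glue k G = (k', q) -> forall v, v != G ->
    narc d k G v = narc d k' (q G) (q v) := @h k G k' q.
  have i1 := @page_inner_intro q0 o3 isT; have i2 := @page_inner_intro q0 o2 isT.
  have i3 := @page_inner_intro q1 o2 isT; have i4 := @page_inner_intro q1 o0 isT.
  have e1 := H _ _ _ _ i1 erefl o0 isT; have e2 := H _ _ _ _ i1 erefl o1 isT.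
  have e3 := H _ _ _ _ i1 erefl o2 isT.
  have e4 := H _ _ _ _ i2 erefl o0 isT; have e5 := H _ _ _ _ i2 erefl o1 isT.
  have e6 := H _ _ _ _ i2 erefl o3 isT.
  have e7 := H _ _ _ _ i3 erefl o3 isT.
  have e8 := H _ _ _ _ i4 erefl o1 isT.
  rewrite /narc /= ?perm1 ?tpermL ?tpermR ?tpermD //= in e1 e2 e3 e4 e5 e6 e7 e8.
  by split; [lra|split; lra|split; lra|split; lra].
case=> e1 [e2 e3] [e4 e5] [e6 e7 e8] k G k' q; move: k G k' q.
apply: page_ind; apply: ord4_ind => // _;
  rewrite /narc /= ?perm1 ?tpermL ?tpermR ?tpermD //=; lra.
Qed.

Lemma page_parallel : @parallel R page_block.
Proof.
move=> d /page_matchingE [e _ _ _]; apply: ord4_ind => // _;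
  rewrite /narc /= ?tpermL ?tpermR ?tpermD //=; lra.
Qed.

(** The general solution has the coordinate t at A and A' in all tetrahedra; (b,
    c, y), (x2, x3, y1) and (z2, z3, y2) are the coordinates at vertices 2 and 3
    and the quadrilateral coordinate in q0, q1 and q2. *)
Definition page_vec (t y b c x2 x3 y1 z2 z3 y2 : nat) (k : 'I_3) :=
  match val k with
  | 0 => tet_vec t t b c y
  | 1 => tet_vec t t x2 x3 y1
  | _ => tet_vec t t z2 z3 y2
  end.

Definition natvec n (c : 'I_n -> option 'I_4 -> nat) : 'I_n -> option 'I_4 -> R :=
  fun i o => (c i o)%:R.

Lemma supported_natvec n (c : 'I_n -> option 'I_4 -> nat) c' i o :
  supported c' (natvec c) -> c i o = 0%N -> c' i o = 0.
Proof. by move=> h ci; apply: h; rewrite /natvec ci. Qed.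

(** The parameters of [page_vec] for the ten fillings with one arc around each
    of the corners 0 and 2 and three around corner 3 of the front triangle. Then
    t + y = 1, b = 1 and c = 3. The first five rows have y = 0, the others y =
    1. Put B = b + y and C = c + y, and let V be the common value of x3 + y1 and
    z2 + y2. The fillings with given y correspond to the solutions of 0 <= y1 <=
    B, 0 <= y2 <= C, y1 <= V, y2 <= V. Since B < C, this polyhedron has the five
    vertices (y1, y2, V) = (0, 0, 0), (B, 0, B), (0, C, C), (B, B, B) and (B, C,
    C). *)
Definition growth_table : seq (seq nat) :=
  [:: [:: 1; 0; 1; 3; 1; 0; 0; 0; 3; 0]; [:: 1; 0; 1; 3; 0; 0; 1; 1; 3; 0];
      [:: 1; 0; 1; 3; 1; 3; 0; 0; 0; 3]; [:: 1; 0; 1; 3; 0; 0; 1; 0; 2; 1];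
      [:: 1; 0; 1; 3; 0; 2; 1; 0; 0; 3];
      [:: 0; 1; 1; 3; 2; 0; 0; 0; 4; 0]; [:: 0; 1; 1; 3; 0; 0; 2; 2; 4; 0];
      [:: 0; 1; 1; 3; 2; 4; 0; 0; 0; 4]; [:: 0; 1; 1; 3; 0; 0; 2; 0; 2; 2];
      [:: 0; 1; 1; 3; 0; 2; 2; 0; 0; 4] ]%N.

Definition growth_vec (k : 'I_10) : 'I_3 -> option 'I_4 -> nat :=
  let f := nth 0%N (nth [::] growth_table k) in
  page_vec (f 0) (f 1) (f 2) (f 3) (f 4) (f 5) (f 6) (f 7) (f 8) (f 9).

(** A filling with neither triangles at vertices 2 and 3 of q1 and q2 nor
    quadrilaterals in q0. In the notation of [page_vec], y1 and y2 equal both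
    the number of arcs around corners 2 and 3 and the number V of
    [growth_table]. *)
Definition tie_vec (s b : nat) := page_vec s 0 b b 0 0 b 0 0 b.

Lemma growth_matching k : @block_matching R page_block (natvec (growth_vec k)).
Proof.
apply/page_matchingE; rewrite /natvec.
case: k => [[|[|[|[|[|[|[|[|[|[|//]]]]]]]]]] h]; rewrite /growth_vec /page_vec /tet_vec /=;
  (split; [|split|split|split]); lra.
Qed.

Lemma tie_matching s b : @block_matching R page_block (natvec (tie_vec s b)).
Proof.
by apply/page_matchingE; rewrite /natvec /=; split; [|split|split|split]; lra.
Qed.

(** Each line succeeds only if the coordinate of the filling computes to zero. *)
Ltac zeros h :=
  try (have := supported_natvec (i := q0) (o := None) h erefl; move=> ?);
  try (have := supported_natvec (i := q0) (o := Some o0) h erefl; move=> ?);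
  try (have := supported_natvec (i := q1) (o := None) h erefl; move=> ?);
  try (have := supported_natvec (i := q1) (o := Some o2) h erefl; move=> ?);
  try (have := supported_natvec (i := q1) (o := Some o3) h erefl; move=> ?);
  try (have := supported_natvec (i := q2) (o := None) h erefl; move=> ?);
  try (have := supported_natvec (i := q2) (o := Some o2) h erefl; move=> ?);
  try (have := supported_natvec (i := q2) (o := Some o3) h erefl; move=> ?).

Lemma growth_determined k : @determined R page_block (natvec (growth_vec k)).
Proof.
move=> d t /page_matchingE [e1 [e2 e3] [e4 e5] [e6 e7 e8]] h st.
have s0 := st o0 isT; have s2 := st o2 isT; have s3 := st o3 isT.
rewrite /narc /natvec /= ?addr0 in s0 s2 s3; clear st.
case: k h s0 s2 s3 => [[|[|[|[|[|[|[|[|[|[|//]]]]]]]]]] hk] h s0 s2 s3; zeros h;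
  rewrite /growth_vec /page_vec /tet_vec /= in s0 s2 s3; clear h;
  apply: ord3_ind; apply: tet_vec_ind;
  rewrite /natvec /growth_vec /page_vec /tet_vec /=; lra.
Qed.

(** The support alone forces the numbers of arcs around two corners of the front
    triangle to coincide. Inserted into a surface, such a block imposes this as
    an additional linear relation. *)
Lemma tie_state s b d : @block_matching R page_block d ->
  supported d (natvec (tie_vec s b)) -> narc d q0 o1 o2 = narc d q0 o1 o3.
Proof.
move=> /page_matchingE [e1 [e2 e3] [e4 e5] [e6 e7 e8]] h; zeros h.
rewrite /narc /=; lra.
Qed.

Lemma tie_determined s b : @determined R page_block (natvec (tie_vec s b)).
Proof.
move=> d t /page_matchingE [e1 [e2 e3] [e4 e5] [e6 e7 e8]] h st.
have s0 := st o0 isT; have s2 := st o2 isT; have s3 := st o3 isT.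
rewrite /narc /natvec /tie_vec /page_vec /tet_vec /= ?addr0 in s0 s2 s3; clear st.
zeros h; clear h.
by apply: ord3_ind; apply: tet_vec_ind;
  rewrite /natvec /tie_vec /page_vec /tet_vec /=; lra.
Qed.

Definition same_vec (x : option 'I_4 -> nat) (k : 'I_2) := x.

Lemma cone_const (d : 'I_2 -> option 'I_4 -> R) :
  d ord0 = d ord_max -> forall k, d k = d ord0.
Proof.
by move=> e; case=> [[|[|//]] hk]; [|rewrite e]; congr d; apply: val_inj.
Qed.

(** Both tetrahedra have equal coordinates, since the five numbers of arcs
    listed in the proof determine a thin vector. *)
Lemma cone_matchingE (d : 'I_2 -> option 'I_4 -> R) :
  @block_matching R cone_block d <-> d ord0 = d ord_max.
Proof.
split.
  move=> h; have H G v : G != o1 -> v != G -> narc d ord0 G v = narc d ord_max G v.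
    move=> G1 vG; have := @h ord0 G _ _ (proj1 (cone_inner _ _) G1) erefl v vG.
    by rewrite /= !perm1 (_ : rev_ord (ord0 : 'I_2) = ord_max) //; apply: val_inj.
  have e0 := H o2 o0 isT isT; have e1 := H o2 o1 isT isT.
  have e2 := H o0 o2 isT isT; have e3 := H o0 o3 isT isT.
  have e4 := H o2 o3 isT isT.
  rewrite /narc /= in e0 e1 e2 e3 e4.
  by apply: boolp.funext; apply: tet_vec_ind; lra.
move=> e k G k' q _ [<- <-] v vG; rewrite !perm1 /narc.
by rewrite !(cone_const e).
Qed.

Lemma cone_parallel : @parallel R cone_block.
Proof.
move=> d /cone_matchingE e v v1; rewrite !perm1 /narc.
by rewrite !(cone_const e).
Qed.

Definition pad_vec := same_vec (tet_vec 1 0 1 3 0).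

Lemma pad_matching : @block_matching R cone_block (natvec pad_vec).
Proof. exact/cone_matchingE. Qed.

Lemma pad_determined : @determined R cone_block (natvec pad_vec).
Proof.
move=> d t /cone_matchingE e h st.
have s0 := st o0 isT; have s2 := st o2 isT; have s3 := st o3 isT.
rewrite /narc /natvec /= ?addr0 in s0 s2 s3; clear st.
have z1 := supported_natvec (i := ord0) (o := Some o1) h erefl.
have z2 := supported_natvec (i := ord0) (o := None) h erefl.
move=> k; rewrite (cone_const e) /natvec /=; apply: tet_vec_ind => /=; lra.
Qed.

End BlockSurfaces.

(** * Spheres with many rigid surfaces *)

Section Family.
Variable R : realType.
Local Notation coords n := ('I_n -> option 'I_4 -> R).

(** Homeomorphic to the double, as realizations are compact and the double is
    Hausdorff. In this form the property passes to insertions by composition. *)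
Definition sphere_like n (T : gluing n) :=
  exists h : realization R T -> realization R double_simplex,
    [/\ continuous h, injective h & forall y, exists x, h x = y].

Lemma sphere_like_double : sphere_like double_simplex.
Proof. by exists id; split=> [y|//|y]; [exact: cvg_id|exists y]. Qed.

Lemma sphere_like_insert n (T : gluing n) (B : block) i a :
  block_map R B -> sphere_like T -> sphere_like (insert T B i a).
Proof.
move=> M [h [hc hi hs]]; have [g [gc gi gs]] := insert_bijection T i a M.
exists (h \o g); split; [exact: cont_comp|exact: inj_comp|].
by move=> y; have [x <-] := hs y; have [z <-] := gs x; exists z.
Qed.

Lemma sphere_like_closed_manifold n (T : gluing n) :
  sphere_like T -> closed_3manifold_triangulation R T.
Proof.
move=> [h [hc hi hs]]; apply: (closed_manifold_transfer _ hc hi hs).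
  exact: realization_compact.
exact: double_closed_manifold.
Qed.

Lemma permV_eq (a : 'S_4) u v : a u = v -> a^-1%g v = u.
Proof. by move=> <-; rewrite permK. Qed.

Lemma tperm_if (x y z : 'I_4) :
  tperm x y z = if z == x then y else if z == y then x else z.
Proof.
case: tpermP => [->|->|/eqP/negbTE-> /eqP/negbTE-> //]; rewrite eqxx //.
by case: eqP.
Qed.

(** The permutation at which blocks are inserted into the root face: the
    vertices 2, 3 and 0 of the root tetrahedron go to 0, 2 and 3. The three
    other permutations place the ties on the faces 2, 3 and 0, bringing the
    corners (0, 3), (2, 0) and (2, 1), respectively, to the corners 2 and 3 of
    the front triangle. *)
Definition rootp : 'S_4 := (tperm o0 o3 * tperm o0 o2)%g.
Definition tiep2 : 'S_4 := (tperm o1 o2 * tperm o0 o2)%g.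
Definition tiep3 : 'S_4 := (tperm o1 o3 * tperm o0 o3)%g.
Definition tiep0 : 'S_4 := (tperm o0 o1 * tperm o0 o3)%g.

Lemma rootpV : [/\ rootp^-1%g o0 = o2, rootp^-1%g o1 = o1, rootp^-1%g o2 = o3 &
  rootp^-1%g o3 = o0].
Proof. by split; apply: permV_eq; rewrite /rootp /tiep2 /tiep3 /tiep0 permM !tperm_if. Qed.

Lemma tiep2V : [/\ tiep2^-1%g o0 = o1, tiep2^-1%g o1 = o2, tiep2^-1%g o2 = o0 &
  tiep2^-1%g o3 = o3].
Proof. by split; apply: permV_eq; rewrite /rootp /tiep2 /tiep3 /tiep0 permM !tperm_if. Qed.

Lemma tiep3V : [/\ tiep3^-1%g o0 = o1, tiep3^-1%g o1 = o3, tiep3^-1%g o2 = o2 &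
  tiep3^-1%g o3 = o0].
Proof. by split; apply: permV_eq; rewrite /rootp /tiep2 /tiep3 /tiep0 permM !tperm_if. Qed.

Lemma tiep0V : [/\ tiep0^-1%g o0 = o3, tiep0^-1%g o1 = o0, tiep0^-1%g o2 = o2 &
  tiep0^-1%g o3 = o1].
Proof. by split; apply: permV_eq; rewrite /rootp /tiep2 /tiep3 /tiep0 permM !tperm_if. Qed.

Lemma double_matchingE (c : coords 2) :
  thin_matching double_simplex c <-> c ord0 = c ord_max.
Proof.
split.
  move=> h; have H G v : v != G -> narc c ord0 G v = narc c ord_max G v.
    move=> vG; have := h ord0 G _ _ erefl v vG.
    by rewrite /= !perm1 (_ : rev_ord (ord0 : 'I_2) = ord_max) //; apply: val_inj.
  have e0 := H o2 o0 isT; have e1 := H o2 o1 isT.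
  have e2 := H o0 o2 isT; have e3 := H o0 o3 isT; have e4 := H o2 o3 isT.
  rewrite /narc /= in e0 e1 e2 e3 e4.
  by apply: boolp.funext; apply: tet_vec_ind; lra.
by move=> e k G k' q [<- <-] v vG; rewrite !perm1 /narc !(cone_const e).
Qed.

Local Notation P := (bsize page_block).

(** Among the vectors (t0, 0, t2, t3, q) on the double, this is the one, up to
    scaling, that satisfies the relations t0 = t3 + q, t2 + q = t0 and t2 = q
    imposed by the ties on faces 2, 3 and 0. *)
Definition base_vec := same_vec (tet_vec 2 0 1 1 1).
Local Notation t0 := (ord0 : 'I_2).

Definition base5 := insert double_simplex page_block t0 tiep2.
Definition base8 := insert base5 page_block (lshift P t0) tiep3.
Definition base11 := insert base8 page_block (lshift P (lshift P t0)) tiep0.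

Definition vec5 : coords (2 + P) := @join R 2 page_block (natvec R base_vec) (natvec R (tie_vec 0 2)).
Definition vec8 : coords (2 + P + P) := @join R _ page_block vec5 (natvec R (tie_vec 0 2)).
Definition vec11 : coords (2 + P + P + P) := @join R _ page_block vec8 (natvec R (tie_vec 1 1)).

Lemma fits5 :
  @fits R 2 page_block t0 tiep2 (natvec R base_vec) (natvec R (tie_vec 0 2)).
Proof.
have [e0 e1 e2 e3] := tiep2V.
by apply: ord4_ind => // _; rewrite /ins_face ?e0 ?e1 ?e2 ?e3 /narc /natvec
  /tie_vec /page_vec /tet_vec /=; lra.
Qed.

Lemma narc_vec5 : narc vec5 (lshift P t0) = narc (natvec R base_vec) t0.
Proof. exact: (@narc_join_l R 2 page_block). Qed.

Lemma narc_vec8 : narc vec8 (lshift P (lshift P t0)) = narc (natvec R base_vec) t0.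
Proof. by rewrite -narc_vec5; exact: (@narc_join_l R _ page_block). Qed.

Lemma fits8 :
  @fits R _ page_block (lshift P t0) tiep3 vec5 (natvec R (tie_vec 0 2)).
Proof.
have [e0 e1 e2 e3] := tiep3V; move=> v v1; rewrite narc_vec5; move: v v1.
by apply: ord4_ind => // _; rewrite /ins_face ?e0 ?e1 ?e2 ?e3 /narc /natvec
  /tie_vec /page_vec /tet_vec /=; lra.
Qed.

Lemma fits11 :
  @fits R _ page_block (lshift P (lshift P t0)) tiep0 vec8 (natvec R (tie_vec 1 1)).
Proof.
have [e0 e1 e2 e3] := tiep0V; move=> v v1; rewrite narc_vec8; move: v v1.
by apply: ord4_ind => // _; rewrite /ins_face ?e0 ?e1 ?e2 ?e3 /narc /natvec
  /tie_vec /page_vec /tet_vec /=; lra.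
Qed.

Lemma vec5_matching : thin_matching base5 vec5.
Proof.
have m2 : thin_matching double_simplex (natvec R base_vec) by apply/double_matchingE.
exact (@thin_extend R 2 double_simplex page_block t0 tiep2 (@page_parallel R) _ _ m2
  (tie_matching R 0 2) fits5).
Qed.

Lemma vec8_matching : thin_matching base8 vec8.
Proof.
exact (@thin_extend R _ base5 page_block _ tiep3 (@page_parallel R) _ _ vec5_matching
  (tie_matching R 0 2) fits8).
Qed.

Lemma vec11_matching : thin_matching base11 vec11.
Proof.
exact (@thin_extend R _ base8 page_block _ tiep0 (@page_parallel R) _ _ vec8_matching
  (tie_matching R 1 1) fits11).
Qed.

Lemma tie_insert n (T : gluing n) i a s b (c : coords n) e :
  thin_matching (insert T page_block i a) e ->
  supported e (@join R n page_block c (natvec R (tie_vec s b))) ->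
  [/\ thin_matching T (lpart e), supported (lpart e) c &
      narc (lpart e) i (ins_face a) (a^-1%g o2) =
      narc (lpart e) i (ins_face a) (a^-1%g o3)].
Proof.
move=> em es.
have [lm rm ft] := @thin_restrict R n T page_block i a (@page_parallel R) e em.
split=> //; first exact: supported_lpart es.
have f2 := ft o2 isT; have f3 := ft o3 isT.
rewrite -f2 -f3; apply: (tie_state rm); exact: (supported_rpart es).
Qed.

(** By [double_matchingE], the restriction of a solution to the double is given
    by five numbers, of which that at vertex 1 vanishes; the three relations
    leave a single degree of freedom. Going back, the fillings of the ties are
    determined by their supports and their boundary arcs. *)
Lemma base_rigid : rigid base11 vec11.
Proof.
split; first exact: vec11_matching.
move=> e em es.
have [m8 s8 r11] := tie_insert em es.
have [m5 s5 r8] := tie_insert m8 s8.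
have [m2 s2 r5] := tie_insert m5 s5.
set e8 := lpart e in m8 s8 r11 m5 s5 r8 m2 s2 r5 *.
set e5 := lpart e8 in r8 m5 s5 m2 s2 r5 *.
set e2 := lpart e5 in m2 s2 r5 *.
have z1 := supported_natvec (i := t0) (o := Some o1) s2 erefl.
have [a0 a1 a2 a3] := tiep0V; have [b0 b1 b2 b3] := tiep3V; have [c0 c1 c2 c3] := tiep2V.
rewrite /ins_face a1 a2 a3 in r11; rewrite /ins_face b1 b2 b3 in r8.
rewrite /ins_face c1 c2 c3 in r5.
change (narc e2 t0 o0 o2 = narc e2 t0 o0 o1) in r11.
change (narc e2 t0 o3 o2 = narc e2 t0 o3 o0) in r8.
rewrite /narc /= in r5 r8 r11.
(* the quadrilateral coordinate of base_vec is 1 *)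
exists (e2 t0 None).
apply: (@determined_join R _ base8 page_block _ tiep0 (@page_parallel R) e _ _ _
  (tie_matching R 1 1) (@tie_determined R 1 1) fits11 em es).
apply: (@determined_join R _ base5 page_block _ tiep3 (@page_parallel R) e8 _ _ _
  (tie_matching R 0 2) (@tie_determined R 0 2) fits8 m8 s8).
apply: (@determined_join R _ double_simplex page_block t0 tiep2 (@page_parallel R) e5 _ _ _
  (tie_matching R 0 2) (@tie_determined R 0 2) fits5 m5 s5).
move/double_matchingE: m2 => m2 k; rewrite -[lpart e5]/e2 (cone_const m2 k).
by apply: tet_vec_ind; rewrite /natvec /=; lra.
Qed.

(** The arcs on the root face 1 of tetrahedron i. They normalize a rigid vector,
    and the front triangle of a [block_surface] has the same arcs in the order
    given by [rootp]. *)
Definition root_state n (i : 'I_n) (c : coords n) :=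
  [/\ narc c i o1 o0 = 3, narc c i o1 o2 = 1 & narc c i o1 o3 = 1].

Definition rich n N := exists (T : gluing n) (i : 'I_n) (I : finType) (c : I -> coords n),
  [/\ sphere_like T, #|I| = N, injective c &
      forall w, [/\ rigid T (c w), root_state i (c w) & forall l o, 0 <= c w l o]].

Definition block_surface (B : block) (d : coords (bsize B)) :=
  [/\ block_matching d, determined d, forall k o, 0 <= d k o &
      [/\ narc d (bfront B) o1 o0 = 1, narc d (bfront B) o1 o2 = 1 &
          narc d (bfront B) o1 o3 = 3]].

Lemma join_ge0 n (B : block) (c : coords n) (d : coords (bsize B)) :
  (forall l o, 0 <= c l o) -> (forall k o, 0 <= d k o) ->
  forall u o, 0 <= join c d u o.
Proof. by move=> c0 d0 u o; rewrite /join; case: (fintype.split u). Qed.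

(** The root face is still a face of the old tetrahedron, with the same arcs, so
    that the next block can be inserted there again. *)
Lemma rich_insert n N (B : block) (J : finType) (d : J -> coords (bsize B)) :
  block_map R B -> parallel R B -> injective d -> (forall w, block_surface (d w)) ->
  rich n N -> rich (n + bsize B) (N * #|J|).
Proof.
move=> M page_B di dB [T [i [I [c [sT cI ci cR]]]]].
exists (insert T B i rootp), (lshift (bsize B) i), (I * J)%type.
exists (fun w => join (c w.1) (d w.2)); split.
- exact: sphere_like_insert.
- by rewrite card_prod cI.
- move=> [x y] [x' y'] /= e; congr (_, _).
    by apply: ci; rewrite -(lpart_join (c x) (d y)) e lpart_join.
  by apply: di; rewrite -(rpart_join (c x) (d y)) e rpart_join.
move=> [x y] /=; have [rx [x0 x2 x3] cx] := cR x.
have [my dy py [y0 y2 y3]] := dB y; split.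
- apply: rigid_insert => //; have [e0 e1 e2 e3] := rootpV.
  by apply: ord4_ind => // _; rewrite /ins_face ?e0 e1 ?e2 ?e3 ?y0 ?y2 ?y3 ?x0 ?x2 ?x3.
- by rewrite /root_state !narc_join_l.
- exact: join_ge0.
Qed.

Lemma natvec_ge0 n (c : 'I_n -> option 'I_4 -> nat) i o : 0 <= natvec R c i o.
Proof. exact: ler0n. Qed.

Lemma rich_base : rich 11 1.
Proof.
exists base11, (lshift P (lshift P (lshift P t0))), unit, (fun _ => vec11); split.
- have M := page_block_map R.
  exact (@sphere_like_insert _ base8 page_block _ tiep0 M
    (@sphere_like_insert _ base5 page_block _ tiep3 M
      (@sphere_like_insert _ double_simplex page_block t0 tiep2 M sphere_like_double))).
- by rewrite card_unit.
- by move=> [] [].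
move=> _; split; first exact: base_rigid.
  have e : narc vec11 (lshift P (lshift P (lshift P t0))) = narc (natvec R base_vec) t0.
    by rewrite -narc_vec8; exact: (@narc_join_l R _ page_block).
  by rewrite /root_state e /narc /natvec /=; split; lra.
have nn := @natvec_ge0.
exact (@join_ge0 _ page_block _ _ (@join_ge0 _ page_block _ _
  (@join_ge0 2 page_block _ _ (@nn _ _) (@nn _ _)) (@nn _ _)) (@nn _ _)).
Qed.

Lemma rich_pad n N : rich n N -> rich (n + 2) N.
Proof.
move=> h; rewrite -[X in rich _ X](muln1 N) -[X in (N * X)%N]card_unit.
refine (@rich_insert n N cone_block _ (fun _ : unit => natvec R pad_vec)
  (cone_block_map R) (@cone_parallel R) _ _ h); first by move=> [] [].
move=> _; split; [exact: pad_matching|exact: pad_determined|exact: natvec_ge0|].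
by rewrite /narc /natvec /=; split; lra.
Qed.

Lemma natvec_inj n (c d : 'I_n -> option 'I_4 -> nat) i o :
  natvec R c = natvec R d -> c i o = d i o.
Proof. by move/(congr1 (fun f => f i o))/eqP; rewrite eqr_nat => /eqP. Qed.

(** The quadrilateral coordinates alone distinguish the ten rows of the table. *)
Lemma growth_vec_inj : injective (fun k => natvec R (growth_vec k)).
Proof.
move=> k k' e; apply/val_inj/eqP.
pose quads (s : seq nat) := [:: nth 0 s 1; nth 0 s 6; nth 0 s 9]%N.
have u : uniq [seq quads s | s <- growth_table] by [].
rewrite -(nth_uniq [::] _ _ u) ?size_map ?ltn_ord // !(nth_map [::]) ?ltn_ord //.
by rewrite /quads; apply/eqP; congr [:: _; _; _];
  [apply: (natvec_inj q0 None e)|apply: (natvec_inj q1 None e)|apply: (natvec_inj q2 None e)].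
Qed.

Lemma rich_growth n N : rich n N -> rich (n + 3) (N * 10).
Proof.
move=> h; rewrite -[X in (N * X)%N](card_ord 10).
refine (@rich_insert n N page_block _ (fun k => natvec R (growth_vec k))
  (page_block_map R) (@page_parallel R) growth_vec_inj _ h).
move=> k; split; [exact: growth_matching|exact: growth_determined|exact: natvec_ge0|].
case: k => [[|[|[|[|[|[|[|[|[|[|//]]]]]]]]]] hk]; rewrite /narc /natvec /growth_vec /page_vec /=;
 by split; lra.
Qed.

Lemma rich_family r k : rich (11 + 2 * r + 3 * k) (10 ^ k).
Proof.
elim: k => [|k IHk].
  rewrite muln0 addn0 expn0; elim: r => [|r IHr]; first exact: rich_base.
  by rewrite mulnS (addnC 2) addnA; exact: rich_pad.
by rewrite mulnS (addnC 3) addnA expnSr; exact: rich_growth.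
Qed.

End Family.

(** * Vertices of the projective solution space *)

Lemma eq_set4 (A B : {set 'I_4}) :
  (A == B) = all (fun x => (x \in A) == (x \in B)) [:: o0; o1; o2; o3].
Proof.
apply/eqP/idP => [->|]; first by rewrite /= !eqxx.
case/and5P => /eqP e0 /eqP e1 /eqP e2 /eqP e3 _.
by apply/finset.setP; apply: ord4_ind.
Qed.

(** Among the three splittings, 01|23 is the one that pairs v with its mate. *)
Lemma pairs_up_mate (Q : quad_type) v F :
  v != F -> pairs_up Q v F -> pairs_up Q o0 o1 = (F == mate v).
Proof.
move=> vF; rewrite /pairs_up => pQ.
have /eqP -> : val Q == [set [set v; F]; ~: [set v; F]]%SET.
  by rewrite -is_splittingP // pQ (valP Q).
rewrite !inE !eq_set4 /= !inE /mate.
by move: v F vF {pQ}; apply: ord4_ind; apply: ord4_ind.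
Qed.

Lemma thin_quad_exists : exists Q, pairs_up Q o0 o1.
Proof. by have [Q [pQ _]] := pairs_up_unique (isT : o0 != o1); exists Q. Qed.

Definition thin_quad : quad_type := xchoose thin_quad_exists.

Lemma thin_quadE Q : pairs_up Q o0 o1 -> Q = thin_quad.
Proof.
have [Q0 [_ u]] := pairs_up_unique (isT : o0 != o1).
by move=> h; exact: etrans (esym (u _ h)) (u _ (xchooseP thin_quad_exists)).
Qed.

Section Vertices.
Variable R : realType.
Local Notation coords n := ('I_n -> option 'I_4 -> R).

Definition full_vec n (c : coords n) (k : normal_type n) : R :=
  match k.2 with
  | inl v => c k.1 (Some v)
  | inr Q => if pairs_up Q o0 o1 then c k.1 None else 0
  end.

(** The inverse of [full_vec] on vectors that vanish on the other
    quadrilaterals. *)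
Definition thin_part n (y : normal_vector R n) : coords n := fun i o =>
  if o is Some v then tri_coord y i v else quad_coord y i thin_quad.

Definition weight n (c : coords n) := \sum_k full_vec c k.

Definition normalized n (c : coords n) : normal_vector R n :=
  [ffun k => full_vec c k / weight c].

Lemma full_vec_thin_quad n (c : coords n) i : full_vec c (i, inr thin_quad) = c i None.
Proof. by rewrite /full_vec /= (xchooseP thin_quad_exists). Qed.

Section Rigid.
Variables (n : nat) (T : gluing n) (c : coords n).
Hypotheses (cR : rigid T c) (c0 : forall i o, 0 <= c i o) (w0 : 0 < weight c).

Lemma full_vec_ge0 k : 0 <= full_vec c k.
Proof. by rewrite /full_vec; case: k => i [v|Q] /=; [|case: ifP]. Qed.

Lemma normalized_matching : matching_equations T (normalized c).
Proof.
move=> i F j p e v vF Q Q' h h'.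
rewrite /tri_coord /quad_coord !ffunE /full_vec /= -!mulrDl.
rewrite (pairs_up_mate vF h) (pairs_up_mate _ h') ?(inj_eq perm_inj) //.
by congr (_ / _); exact: (cR.1 _ _ _ _ e _ vF).
Qed.

Lemma normalized_solution : projective_solution_space T (normalized c).
Proof.
split; first 2 last.
- under eq_bigr do rewrite ffunE.
  by rewrite -mulr_suml mulfV ?gt_eqF.
- by move=> k; rewrite ffunE divr_ge0 ?full_vec_ge0 // ltW.
exact: normalized_matching.
Qed.

(** Smaller support means that y comes from a thin vector, which is a multiple
    of c by rigidity; the factor is fixed by the condition that the coordinates
    sum to 1. *)
Lemma normalized_unique (y : normal_vector R n) : projective_solution_space T y ->
  (forall k, normalized c k = 0 -> y k = 0) -> y = normalized c.
Proof.
move=> [y0 yM y1] ys.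
have s k : full_vec c k = 0 -> y k = 0.
  by move=> e; apply: ys; rewrite ffunE e mul0r.
have quadE i v F Q : v != F -> pairs_up Q v F ->
    quad_coord y i Q = if F == mate v then thin_part y i None else 0.
  move=> vF h; rewrite -(pairs_up_mate vF h); case: ifPn => [/thin_quadE->//|nQ].
  by apply: s; rewrite /full_vec /= (negbTE nQ).
have tm : thin_matching T (thin_part y).
  move=> i F j p e v vF; have pvF : p v != p F by rewrite (inj_eq perm_inj).
  have [Q [h _]] := pairs_up_unique vF; have [Q' [h' _]] := pairs_up_unique pvF.
  by have := yM _ _ _ _ e _ vF _ _ h h'; rewrite (quadE _ _ _ _ vF h) (quadE _ _ _ _ pvF h').
have ts : supported (thin_part y) c.
  move=> i [v|] e; apply: s; last by rewrite full_vec_thin_quad.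
  by rewrite /full_vec.
have [t pt] := cR.2 _ tm ts.
have yE k : y k = t * full_vec c k.
  case: k => i [v|Q]; first exact: (pt i (Some v)).
  rewrite /full_vec /=; case: ifPn => [/thin_quadE->|nQ]; first exact: (pt i None).
  by rewrite mulr0; apply: s; rewrite /full_vec /= (negbTE nQ).
have tw : t * weight c = 1.
  by rewrite -y1 mulr_sumr; apply: eq_bigr => k _; rewrite yE.
apply/ffunP => k; rewrite yE ffunE mulrC; congr (_ * _).
by apply: (mulIf (lt0r_neq0 w0)); rewrite tw mulVf ?gt_eqF.
Qed.

(** If the normalized vector is a proper convex combination of two solutions,
    both have smaller support, and are equal to it by [normalized_unique]. The
    quadrilateral constraints hold because only one of the three types is used. *)
Lemma normalized_admissible : admissible_vertices T (normalized c).
Proof.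
split; last first.
  move=> i Q Q'; rewrite /quad_coord !ffunE /full_vec /=.
  case: ifPn => [/thin_quadE->|_]; last by rewrite mul0r eqxx.
  by case: ifPn => [/thin_quadE->|_] //; rewrite mul0r eqxx.
split=> [|y z t Py Pz /andP[t0 t1] e]; first exact: normalized_solution.
have s k : normalized c k = 0 -> y k = 0 /\ z k = 0.
  rewrite e !ffunE => h; have t1' : 0 < 1 - t by rewrite subr_gt0.
  have [y0 z0] : 0 <= (y k : R) /\ 0 <= (z k : R) by split; [case: Py|case: Pz].
  have a : 0 <= t * (y k : R) by rewrite mulr_ge0 // ltW.
  have b : 0 <= (1 - t) * (z k : R) by rewrite mulr_ge0 // ltW.
  have := paddr_eq0 a b; rewrite [X in X == 0]h eqxx => /esym/andP[].
  by rewrite !mulf_eq0 (gt_eqF t0) (gt_eqF t1') => /eqP -> /eqP ->.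
rewrite (normalized_unique Py) => [|k /s[]//].
by rewrite (normalized_unique Pz) => // k /s[].
Qed.

End Rigid.

Lemma weight_gt0 n (i : 'I_n) (c : coords n) :
  (forall i o, 0 <= c i o) -> root_state i c -> 0 < weight c.
Proof.
move=> c0 [_ h _]; have f0 k : 0 <= full_vec c k.
  by rewrite /full_vec; case: k => l [v|Q] /=; [|case: ifP].
rewrite lt_def sumr_ge0 ?andbT //; apply/eqP => /eqP.
rewrite psumr_eq0 // => /allP z.
have e2 := z (i, inl o2) (mem_index_enum _).
move: h; rewrite /narc /= addr0 => h; move: e2; rewrite /= /full_vec /= h.
by rewrite oner_eq0.
Qed.

(** The arcs on the root face determine the scaling. *)
Lemma normalized_inj n (i : 'I_n) (c c' : coords n) :
  0 < weight c -> 0 < weight c' -> root_state i c -> root_state i c' ->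
  normalized c = normalized c' -> c = c'.
Proof.
move=> w0 w0' [_ h _] [_ h' _] e.
have E k : full_vec c k / weight c = full_vec c' k / weight c'.
  by have := congr1 (fun f : normal_vector R n => f k) e; rewrite !ffunE.
have := E (i, inl o2); move: h h'; rewrite /narc /= !addr0 /full_vec /= => -> ->.
rewrite !div1r => /invr_inj ew; rewrite ew in E.
have {}E k : full_vec c k = full_vec c' k.
  by apply: (mulIf _ (E k)); rewrite invr_eq0 gt_eqF.
apply: boolp.funext => l; apply: boolp.funext => -[v|].
  exact: (E (l, inl v)).
by rewrite -!full_vec_thin_quad.
Qed.

Lemma sigma_rich n N : rich R n N ->
  exists T : gluing n, closed_3manifold_triangulation R T /\ (N <= sigma R T)%N.
Proof.
move=> [T [i [I [c [sT <- ci cP]]]]]; exists T.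
split; first exact: sphere_like_closed_manifold.
have w0 w : 0 < weight (c w) by have [_ ? ?] := cP w; apply: (@weight_gt0 _ i).
have u : uniq [seq normalized (c w) | w <- enum I].
  rewrite map_inj_uniq ?enum_uniq // => w w' e; apply: ci.
  have [_ r _] := cP w; have [_ r' _] := cP w'.
  exact: (normalized_inj (w0 w) (w0 w') r r').
rewrite cardE -(size_map (fun w => normalized (c w))); apply: uniq_leq_size => //.
move=> x /mapP[w _ ->]; rewrite in_fset_set; last exact: finite_admissible_vertices.
by apply/mem_set; have [r _ c0] := cP w; exact: normalized_admissible.
Qed.

End Vertices.

(** * The growth rate *)

(** Two or four tetrahedra of padding correct the residue of n modulo 3. *)
Lemma size_split n : (15 <= n)%N -> exists r k,
  n = (11 + 2 * r + 3 * k)%N /\ (n <= 3 * k + 15)%N.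
Proof.
move=> n15; have := ltn_pmod (n - 11) (isT : 0 < 3)%N.
have := divn_eq (n - 11) 3; move: ((n - 11) %/ 3)%N ((n - 11) %% 3)%N => q s e s3.
by case: s e s3 => [|[|[|//]]] e _; [exists 0, q|exists 2, q.-1|exists 1, q]; lia.
Qed.

(** Both sides are k-th powers, and 17 ^ (3/4) <= 10 follows from 17 ^ 3 <= 10 ^
    4. *)
Lemma rate_le (R : realType) (k : nat) : (17 : R) `^ ((3 * k)%:R / 4) <= 10 ^+ k.
Proof.
have -> : (3 * k)%:R / 4 = (3 / 4) * k%:R :> R by rewrite natrM; field.
rewrite powRrM powR_mulrn ?powR_ge0 // lerXn2r ?nnegrE ?powR_ge0 //.
rewrite -(@ler_pXn2r _ 4) ?nnegrE ?powR_ge0 //.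
rewrite -powR_mulrn ?powR_ge0 // -powRrM.
have -> : 3 / 4 * 4%:R = 3%:R :> R by field.
rewrite powR_mulrn //; lra.
Qed.

Theorem corollary9 (R : realType) (f : nat -> R)
    (hf : forall (n : nat) (T : gluing n), (0 < n)%N ->
      closed_3manifold_triangulation R T -> (sigma R T)%:R <= f n) :
  exists (c : R) (n0 : nat), 0 < c /\
    forall n : nat, (n0 <= n)%N -> c * 17 `^ (n%:R / 4) <= f n.
Proof.
(* the constant absorbs the 15 tetrahedra not counted by 3 k *)
exists (17 `^ (- (15 / 4))), 15%N; split; first by rewrite powR_gt0.
move=> n n15; have [r [k [nE nk]]] := size_split n15.
have [T [mT sT]] := sigma_rich (rich_family R r k).
rewrite -nE in T mT sT; have n0 : (0 < n)%N by exact: leq_trans n15.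
apply: le_trans (hf n T n0 mT).
rewrite -powRD; last by rewrite (_ : (17 : R) != 0) ?implybT // pnatr_eq0.
apply: (@le_trans _ _ (10 ^+ k)); last by rewrite -natrX ler_nat.
apply: le_trans (rate_le R k); apply: ler_powR; first lra.
have : n%:R <= (3 * k + 15)%:R :> R by rewrite ler_nat.
by rewrite !natrD => ?; lra.
Qed.
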